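(* Let $P\in\mathbb{Q}^{d\times d}$ be a stochastic, irreducible matrix, $\iota\in\mathbb{Q}^d$ an initial distribution, and $w\colon\mathbb{R}^d\to\mathbb{R}$ a continuous weight function. Then one can compute, in polynomial time (in the bit length of $(P,\iota)$), points $\pi_0,\ldots,\pi_{L-1}\in\mathbb{Q}^d$ for some $L\le d$ such that $$\mathcal{MP}_w(P,\iota)=\frac1L\sum_{i=0}^{L-1}w(\pi_i).$$
   Context: A matrix $P\in\mathbb{R}^{d\times d}$ is stochastic if its entries are non-negative and each column sums to $1$ (column convention: $P_{ij}$ is the probability of moving from state $j$ to state $i$). An initial distribution is a vector with non-negative entries summing to $1$. $P$ is irreducible if in the Markov chain on $\{1,\ldots,d\}$ with these transition probabilities every state is reachable from every other state. The mean payoff is $\mathcal{MP}_w(P,\iota)=\lim_{n\to\infty}\frac1n\sum_{k=0}^{n-1}w(P^k\iota)$. *)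

(* Defs.v *)
From HB Require Import structures.
From mathcomp Require Import all_boot all_order all_algebra.
From mathcomp Require Import all_classical all_reals all_analysis.

Set Implicit Arguments.
Unset Strict Implicit.
Unset Printing Implicit Defensive.

Import Order.TTheory GRing.Theory Num.Theory.
Import numFieldNormedType.Exports.

Local Open Scope ring_scope.

(* Column convention: [P i j] is the probability of moving from j to i. *)
Definition stochastic (R : numDomainType) (d : nat) (P : 'M[R]_d) : Prop :=
  (forall i j, 0 <= P i j) /\ (forall j, \sum_i P i j = 1).

Definition distribution_vector (R : numDomainType) (d : nat) (v : 'cV[R]_d)
  : Prop :=
  (forall i, 0 <= v i 0) /\ \sum_i v i 0 = 1.

Definition transition (R : numDomainType) (d : nat) (P : 'M[R]_d)
  : rel 'I_d := fun j i => 0 < P i j.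

Definition irreducible_chain (R : numDomainType) (d : nat) (P : 'M[R]_d)
  : Prop :=
  forall j i, connect (transition P) j i.

(* The term of index 0 is 0, since 0^-1 = 0; it does not affect the limit. *)
Definition average_payoff (R : realType) (d : nat) (w : 'cV[R]_d -> R)
    (P : 'M[R]_d) (iota : 'cV[R]_d) (n : nat) : R :=
  n%:R^-1 * \sum_(k < n) w (P ^+ k *m iota).

(* Meaningful only when the averages converge. *)
Definition mean_payoff (R : realType) (d : nat) (w : 'cV[R]_d -> R)
    (P : 'M[R]_d) (iota : 'cV[R]_d) : R :=
  limn (average_payoff w P iota).

(* Model of computation: random access machine with the operations
   +, -, *, / on integers of arbitrary size, under the logarithmic cost
   criterion (Aho, Hopcroft, Ullman), programmed with structured control flow.
   Polynomial time in this model coincides with polynomial time on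
   Turing machines. *)

(* Number of binary digits of |z|, with bit_length 0 = 1. *)
Definition bit_length (z : int) : nat := (trunc_log 2 `|z|).+1.

(* [s a i] is cell i of array a; a program names finitely many arrays. *)
Definition memory := nat -> int -> int.

Inductive expr : Type :=
| Const of int
| Get of nat & expr
| Plus of expr & expr
| Minus of expr & expr
| Times of expr & expr
| Quot of expr & expr.

Fixpoint eval (s : memory) (e : expr) : int :=
  match e with
  | Const z => z
  | Get a e1 => s a (eval s e1)
  | Plus e1 e2 => eval s e1 + eval s e2
  | Minus e1 e2 => eval s e1 - eval s e2
  | Times e1 e2 => eval s e1 * eval s e2
  | Quot e1 e2 => (eval s e1 %/ eval s e2)%Z
  end.

(* Each intermediate value, including each address, is charged its length. *)
Fixpoint eval_cost (s : memory) (e : expr) : nat :=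
  (bit_length (eval s e) +
  match e with
  | Const _ => 0
  | Get _ e1 => eval_cost s e1
  | Plus e1 e2 | Minus e1 e2 | Times e1 e2 | Quot e1 e2 =>
      eval_cost s e1 + eval_cost s e2
  end)%N.

(* [Store a e1 e2] is the assignment a[e1] := e2; the tests of [If] and
   [While] are "e > 0". *)
Inductive command : Type :=
| Skip
| Store of nat & expr & expr
| Seq of command & command
| If of expr & command & command
| While of expr & command.

Definition update (s : memory) (a : nat) (i v : int) : memory :=
  fun b j => if (b == a) && (j == i) then v else s b j.

(* [exec c s s' t]: started in s, the program c halts in s' at cost t. *)
Inductive exec : command -> memory -> memory -> nat -> Prop :=
| exec_skip s : exec Skip s s 1
| exec_store s a e1 e2 :
    exec (Store a e1 e2) s (update s a (eval s e1) (eval s e2))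
      (eval_cost s e1 + eval_cost s e2).+1
| exec_seq s1 s2 s3 c1 c2 t1 t2 :
    exec c1 s1 s2 t1 -> exec c2 s2 s3 t2 ->
    exec (Seq c1 c2) s1 s3 (t1 + t2)
| exec_if_true s s' e c1 c2 t :
    0 < eval s e -> exec c1 s s' t ->
    exec (If e c1 c2) s s' (eval_cost s e + t).+1
| exec_if_false s s' e c1 c2 t :
    eval s e <= 0 -> exec c2 s s' t ->
    exec (If e c1 c2) s s' (eval_cost s e + t).+1
| exec_while_true s1 s2 s3 e c t1 t2 :
    0 < eval s1 e -> exec c s1 s2 t1 -> exec (While e c) s2 s3 t2 ->
    exec (While e c) s1 s3 (eval_cost s1 e + t1 + t2).+1
| exec_while_false s e c :
    eval s e <= 0 -> exec (While e c) s s (eval_cost s e).+1.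

Definition rat_bits (q : rat) : nat :=
  (bit_length (numq q) + bit_length (denq q))%N.

(* At least 2 d (d + 1), so the dimension needs no separate summand. *)
Definition input_bits (d : nat) (P : 'M[rat]_d) (iota : 'cV[rat]_d) : nat :=
  (\sum_i \sum_j rat_bits (P i j) + \sum_i rat_bits (iota i 0%R))%N.

(* The dimension, then the entries of P row by row, then those of iota;
   each entry is its numerator followed by its denominator. *)
Definition encode_input (d : nat) (P : 'M[rat]_d) (iota : 'cV[rat]_d)
  : seq int :=
  d%:Z :: flatten [seq [:: numq q; denq q] |
    q <- [seq P i j | i <- enum 'I_d, j <- enum 'I_d]
           ++ [seq iota i 0 | i <- enum 'I_d]].

(* The input occupies array 0 from cell 0 on; all other cells contain 0. *)
Definition initial_memory (input : seq int) : memory :=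
  fun a i => if a is 0%N then if i is Posz k then nth 0 input k else 0 else 0.

(* Output in array 1: L in cell 0, and coordinate j of point i as the fraction
   of the cells 2 (i d + j) + 1 and 2 (i d + j) + 2, not necessarily reduced. *)
Definition encodes_output (d L : nat) (s : memory) (p : 'I_L -> 'cV[rat]_d)
  : Prop :=
  s 1%N 0 = L%:Z /\
  forall (i : 'I_L) (j : 'I_d),
    let k := (2 * (i * d + j))%N in
    s 1%N (k.+2)%:Z != 0 /\
    p i j 0 = (s 1%N (k.+1)%:Z)%:~R / (s 1%N (k.+2)%:Z)%:~R.

(* Main.v *)
(* Let B_m be the 0-1 pattern of P^m.  By pigeonhole B_m is periodic from
   N = 2^(d*d) on, with least period L.  Two walks with the same ends whose
   lengths differ modulo L would give a smaller period, so for all i, j exactly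
   one residue of m modulo L allows a walk of length m >= N from j to i; hence
   L <= d, and with the stationary distribution alpha the matrices
   E_m = L alpha_i (B_m)_ij satisfy P E_m = E_m P = E_(m+1) and are stochastic
   and L-periodic.  For a large multiple M of L, E_M is idempotent and
   P^M >= e E_M entrywise, so P^(Mn) - E_M = (1 - e)^n (H^n - E_M) with H
   stochastic: P^m - E_m tends to 0, and Cesaro averaging gives the mean payoff
   with the L points E_(N'+k) iota for any N' >= N.

   The program works on D P, with D a common denominator.  It obtains B_N by
   d*d Boolean squarings, then L by comparing B_(N+k) with B_N for k <= d.  The
   vector alpha is a column of adj (D I - D P), the last matrix of the
   Faddeev-LeVerrier recursion; its entries grow at most by the factor 2 d^2 D
   per step, so that no determinant bound is needed. *)

Require Import Defs.
From HB Require Import structures.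
From mathcomp Require Import all_boot all_order all_fingroup all_algebra.
From mathcomp Require Import all_classical all_reals all_analysis.
From mathcomp Require Import zify ring lra.

Set Implicit Arguments.
Unset Strict Implicit.
Unset Printing Implicit Defensive.

Import Order.TTheory GRing.Theory Num.Theory.
Import numFieldNormedType.Exports.

Local Open Scope ring_scope.
Local Notation eval := Defs.eval.

(** * Polynomial-time programs *)

(** Running time is separated from correctness: the algorithm is written with counted loops and no
    conditionals, so its cost is polynomial by recursion on the program text as soon as all stored
    values have polynomial length. That length is the real obstacle, since a product repeated in a
    loop may double lengths at each turn; hence 0-1 patterns in place of powers of [P], and a bound
    on every matrix of the Faddeev-LeVerrier recursion. The exponent N, the number of 0-1 matrices
    of size d, is exponential in d, but it is never stored: squaring reaches it.

    The adjugate is chosen because it yields a kernel vector by integer operations in which every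
    division is exact. A column of it might vanish a priori; a maximum principle shows that its
    diagonal entry does not. Its sign is unknown, but division by the sum of the entries cancels
    it. *)

Definition polybounded (f : nat -> nat) : Prop :=
  exists T : {poly nat}, forall n, (f n <= T.[n])%N.

Lemma polybounded_cst (c : nat) : polybounded (fun=> c).
Proof. by exists c%:P => n; rewrite hornerC. Qed.

Lemma polybounded_id : polybounded id.
Proof. by exists 'X => n; rewrite hornerX. Qed.

Lemma polyboundedD (f g : nat -> nat) :
  polybounded f -> polybounded g -> polybounded (fun n => f n + g n)%N.
Proof.
move=> [S fS] [T gT]; exists (S + T) => n.
by rewrite hornerD; apply: leq_add.
Qed.

Lemma polyboundedM (f g : nat -> nat) :
  polybounded f -> polybounded g -> polybounded (fun n => f n * g n)%N.
Proof.
move=> [S fS] [T gT]; exists (S * T) => n.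
by rewrite hornerM; apply: leq_mul.
Qed.

(** A language without [If] and [While], in which every program terminates: its effect is the total
    function [run], and case distinctions are made by arithmetic. *)
Inductive code : Type :=
| Asg of nat & expr & expr
| Then of code & code
| Loop of nat & expr & code.

(* [Loop x e c] runs c with cell 0 of array x going through 0, ..., e - 1. *)
Fixpoint compile (c : code) : command :=
  match c with
  | Asg a e1 e2 => Store a e1 e2
  | Then c1 c2 => Seq (compile c1) (compile c2)
  | Loop x e c1 =>
      Seq (Store x (Const 0) (Const 0))
        (While (Minus e (Get x (Const 0)))
          (Seq (compile c1)
            (Store x (Const 0) (Plus (Get x (Const 0)) (Const 1)))))
  end.

Definition loop_step (f : memory -> memory) (x : nat) (s : memory) : memory :=
  update (f s) x 0 (f s x 0 + 1).

Fixpoint run (c : code) (s : memory) : memory :=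
  match c with
  | Asg a e1 e2 => update s a (eval s e1) (eval s e2)
  | Then c1 c2 => run c2 (run c1 s)
  | Loop x e c1 => iter `|eval s e| (loop_step (run c1) x) (update s x 0 0)
  end.

Fixpoint writes (c : code) : seq nat :=
  match c with
  | Asg a _ _ => [:: a]
  | Then c1 c2 => writes c1 ++ writes c2
  | Loop x _ c1 => x :: writes c1
  end.

Fixpoint reads (e : expr) : seq nat :=
  match e with
  | Const _ => [::]
  | Get a e1 => a :: reads e1
  | Plus e1 e2 | Minus e1 e2 | Times e1 e2 | Quot e1 e2 => reads e1 ++ reads e2
  end.

(** [run] evaluates a loop bound once, before the counter is reset, whereas the compiled [While]
    evaluates it at each test. They agree because no array that the loop writes, that of the counter
    included, occurs in the bound. *)
Fixpoint well_formed (c : code) : bool :=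
  match c with
  | Asg _ _ _ => true
  | Then c1 c2 => well_formed c1 && well_formed c2
  | Loop x e c1 =>
      [&& x \notin writes c1, ~~ has (mem (x :: writes c1)) (reads e)
        & well_formed c1]
  end.

Definition small (V : nat) (z : int) : bool := (`|z| < 2 ^ V)%N.

Definition small_memory (V : nat) (s : memory) : Prop :=
  forall a i, small V (s a i).

(* V bounds the lengths of the stored values, M the numbers of iterations. *)
Fixpoint safe (V M : nat) (c : code) (s : memory) : Prop :=
  match c with
  | Asg a _ e2 => small V (eval s e2)
  | Then c1 c2 => safe V M c1 s /\ safe V M c2 (run c1 s)
  | Loop x e c1 =>
      [/\ 0 <= eval s e, (`|eval s e| <= M)%N &
        forall k, (k < `|eval s e|)%N ->
          safe V M c1 (iter k (loop_step (run c1) x) (update s x 0 0))]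
  end.

Lemma update_other (s : memory) (a : nat) (i v : int) (b : nat) :
  b != a -> update s a i v b =1 s b.
Proof. by move=> /negPf ba j; rewrite /update ba. Qed.

Lemma run_frame (c : code) (s : memory) (a : nat) :
  a \notin writes c -> run c s a =1 s a.
Proof.
elim: c s => [b e1 e2|c1 IH1 c2 IH2|x e c IH] s /=.
- by rewrite inE => ab; exact: update_other.
- by rewrite mem_cat negb_or => /andP[a1 a2] i; rewrite IH2 // IH1.
- rewrite inE negb_or => /andP[ax ac] i; elim: `|eval s e|%N => [|k IHk] /=.
    by rewrite update_other.
  by rewrite /loop_step update_other // IH.
Qed.

Lemma eval_frame (e : expr) (s s' : memory) :
  (forall a, a \in reads e -> s' a =1 s a) -> eval s' e = eval s e.
Proof.
elim: e => //= [a e1 IH1 h|e1 IH1 e2 IH2 h|e1 IH1 e2 IH2 h|e1 IH1 e2 IH2 h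
  |e1 IH1 e2 IH2 h]; last 4 first.
- 1-4: by rewrite IH1 ?IH2 // => a ae; apply: h; rewrite mem_cat ae ?orbT.
rewrite IH1 => [|b be]; first by rewrite h // inE eqxx.
by apply: h; rewrite inE be orbT.
Qed.

Section LoopInvariant.
Variables (x : nat) (e : expr) (c : code) (s : memory).
Hypothesis wf : well_formed (Loop x e c).
Let state k := iter k (loop_step (run c) x) (update s x 0 0).

Lemma loop_counter (k : nat) : state k x 0 = k%:Z.
Proof.
case/and3P: wf => xc _ _; elim: k => [|k IH] /=; first by rewrite /update !eqxx.
by rewrite /loop_step /update !eqxx run_frame //= IH -PoszD addn1.
Qed.

Lemma loop_frame (k : nat) (a : nat) :
  a \notin x :: writes c -> state k a =1 s a.
Proof.
rewrite inE negb_or => /andP[ax ac] i; elim: k => [|k IH] /=.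
  by rewrite update_other.
by rewrite /loop_step update_other // run_frame.
Qed.

Lemma loop_bound (k : nat) : eval (state k) e = eval s e.
Proof.
case/and3P: wf => _ /hasPn h _; apply: eval_frame => a /h ha.
by apply: loop_frame.
Qed.

Lemma loop_hoare (V M : nat) (I : nat -> memory -> Prop) (n : nat) :
  eval s e = n%:Z -> (n <= M)%N ->
  I 0%N (update s x 0 0) ->
  (forall k s', (k < n)%N -> s' x 0 = k%:Z ->
     (forall a, a \notin x :: writes c -> s' a =1 s a) -> I k s' ->
     safe V M c s' /\ I k.+1 (loop_step (run c) x s')) ->
  safe V M (Loop x e c) s /\ I n (run (Loop x e c) s).
Proof.
move=> en nM I0 IS.
have Ik k : (k <= n)%N -> I k (state k).
  elim: k => [//|k IH] kn.
  have [] // := IS k (state k) kn (loop_counter k) _ (IH (ltnW kn)).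
  by move=> a ha; exact: loop_frame.
rewrite /= en absz_nat; split; last exact: Ik.
split=> // k kn.
have [] // := IS k (state k) kn (loop_counter k) _ (Ik _ (ltnW kn)).
by move=> a ha; exact: loop_frame.
Qed.

End LoopInvariant.

(** Lengths are added even for sums and differences, where their maximum plus one would do:
    expressions are fixed, so only a bound polynomial in [V] matters. *)
Fixpoint expr_bits (V : nat) (e : expr) : nat :=
  match e with
  | Const z => bit_length z
  | Get _ _ => V
  | Plus e1 e2 | Minus e1 e2 => (expr_bits V e1 + expr_bits V e2).+1
  | Times e1 e2 => (expr_bits V e1 + expr_bits V e2)%N
  | Quot e1 e2 => expr_bits V e1
  end.

Fixpoint expr_cost (V : nat) (e : expr) : nat :=
  ((expr_bits V e).+1 +
  match e with
  | Const _ => 0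
  | Get _ e1 => expr_cost V e1
  | Plus e1 e2 | Minus e1 e2 | Times e1 e2 | Quot e1 e2 =>
      expr_cost V e1 + expr_cost V e2
  end)%N.

Lemma small_bit_length (z : int) : small (bit_length z) z.
Proof. exact: trunc_log_ltn. Qed.

Lemma bit_length_small (V : nat) (z : int) : small V z -> (bit_length z <= V.+1)%N.
Proof.
rewrite /small /bit_length ltnS => zV; case: (posnP `|z|%N) => [->|z0].
  by rewrite trunc_log0.
rewrite -(leq_exp2l (m := 2)) //; apply: ltnW; apply: leq_ltn_trans zV.
exact: trunc_logP.
Qed.

Lemma smallW (U V : nat) (z : int) : (U <= V)%N -> small U z -> small V z.
Proof. by move=> UV /leq_trans; apply; rewrite leq_exp2l. Qed.

Lemma smallD (U V : nat) (y z : int) :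
  small U y -> small V z -> small (U + V).+1 (y + z).
Proof.
rewrite /small => yU zV.
have yz : (`|(y + z)%R|%N <= `|y|%N + `|z|%N)%N by lia.
apply: leq_ltn_trans yz _.
have U0 : (0 < 2 ^ U)%N by rewrite expn_gt0.
have V0 : (0 < 2 ^ V)%N by rewrite expn_gt0.
rewrite expnS expnD; nia.
Qed.

Lemma smallN (V : nat) (z : int) : small V (- z) = small V z.
Proof. by rewrite /small abszN. Qed.

Lemma smallM (U V : nat) (y z : int) :
  small U y -> small V z -> small (U + V) (y * z).
Proof. by rewrite /small abszM expnD => *; rewrite ltn_mul. Qed.

Lemma abs_divz_le (y z : int) : (`|(y %/ z)%Z| <= `|y|)%N.
Proof.
have [->|z0] := eqVneq z 0; first by rewrite divz0.
have := divz_eq y z; have := modz_ge0 y z0; have := ltz_mod y z0.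
set q := (y %/ z)%Z; set r := (y %% z)%Z => h1 h2 h3.
have [zn|zp] : z < 0 \/ 0 < z by lia.
  by nia.
by nia.
Qed.

Lemma small_eval (V : nat) (s : memory) (e : expr) :
  small_memory V s -> small (expr_bits V e) (eval s e).
Proof.
move=> sV; elim: e => /= [z|a e1 _|e1 IH1 e2 IH2|e1 IH1 e2 IH2|e1 IH1 e2 IH2
  |e1 IH1 e2 IH2].
- exact: small_bit_length.
- exact: sV.
- exact: smallD.
- by apply: smallD => //; rewrite smallN.
- exact: smallM.
- exact: leq_ltn_trans (abs_divz_le _ _) IH1.
Qed.

Lemma eval_cost_le (V : nat) (s : memory) (e : expr) :
  small_memory V s -> (eval_cost s e <= expr_cost V e)%N.
Proof.
move=> sV; have bits e' := bit_length_small (small_eval e' sV).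
by elim: e => [z|a e1 IH1|e1 IH1 e2 IH2|e1 IH1 e2 IH2|e1 IH1 e2 IH2
  |e1 IH1 e2 IH2]; (apply: leq_add; first exact: bits); rewrite ?leq_add.
Qed.

Fixpoint code_cost (V M : nat) (c : code) : nat :=
  match c with
  | Asg _ e1 e2 => (expr_cost V e1 + expr_cost V e2).+1
  | Then c1 c2 => (code_cost V M c1 + code_cost V M c2)%N
  | Loop x e c1 =>
      let test := (expr_cost V (Minus e (Get x (Const 0)))).+1 in
      let step := (expr_cost V (Const 0) +
        expr_cost V (Plus (Get x (Const 0)) (Const 1))).+1 in
      ((expr_cost V (Const 0) + expr_cost V (Const 0)).+1 +
       (M * (test + code_cost V M c1 + step) + test))%N
  end.

Lemma small_update (V : nat) (s : memory) (a : nat) (i v : int) :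
  small_memory V s -> small V v -> small_memory V (update s a i v).
Proof. by move=> sV vV b j; rewrite /update; case: ifP. Qed.

(** The hypothesis [M < 2 ^ V] takes care of the loop counters: they are stored values too, but
    [safe] does not check their length. *)
Lemma exec_run (V M : nat) (c : code) (s : memory) :
  (M < 2 ^ V)%N -> well_formed c -> safe V M c s -> small_memory V s ->
  small_memory V (run c s) /\
  exists2 t, exec (compile c) s (run c s) t & (t <= code_cost V M c)%N.
Proof.
move=> MV; elim: c s => [a e1 e2|c1 IH1 c2 IH2|x e c IH] s.
- move=> _ vV sV; split; first exact: small_update.
  exists (eval_cost s e1 + eval_cost s e2).+1; first exact: exec_store.
  by rewrite /= ltnS leq_add // eval_cost_le.
- move=> /andP[wf1 wf2] [safe1 safe2] sV.
  have [s1V [t1 exec1 t1V]] := IH1 s wf1 safe1 sV.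
  have [s2V [t2 exec2 t2V]] := IH2 _ wf2 safe2 s1V.
  split=> //; exists (t1 + t2)%N; last exact: leq_add.
  exact: exec_seq exec1 exec2.
- move=> wf [e0 eM safek] sV; have /and3P[xc _ wfc] := wf.
  pose n := `|eval s e|%N.
  pose state k := iter k (loop_step (run c) x) (update s x 0 0).
  have zero_small v : small V (v%:Z) = (v < 2 ^ V)%N by [].
  have counter k : state k x 0 = k%:Z by exact: loop_counter wf k.
  have stateV k : (k <= n)%N -> small_memory V (state k).
    elim: k => [_|k IHk kn] /=.
      by apply: small_update => //; rewrite zero_small expn_gt0.
    have [kV _] := IH (state k) wfc (safek k kn) (IHk (ltnW kn)).
    apply: small_update => //; rewrite run_frame // -/(state k) counter.
    rewrite -PoszD zero_small addn1.
    exact: leq_ltn_trans kn (leq_ltn_trans eM MV).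
  have guard k : eval (state k) (Minus e (Get x (Const 0))) = n%:Z - k%:Z.
    by rewrite /= counter (loop_bound s wf) /n gez0_abs.
  set test := (expr_cost V (Minus e (Get x (Const 0)))).+1.
  set step := (expr_cost V (Const 0) +
      expr_cost V (Plus (Get x (Const 0)) (Const 1))).+1.
  (* Induction on the number [m] of remaining turns, since [exec_while_true] unrolls a loop from its
     first turn. *)
  have while m : (m <= n)%N -> exists2 t,
      exec (While (Minus e (Get x (Const 0)))
        (Seq (compile c) (Store x (Const 0) (Plus (Get x (Const 0)) (Const 1)))))
        (state (n - m)%N) (state n) t
      & (t <= m * (test + code_cost V M c + step) + test)%N.
    elim: m => [|m IHm] mn.
      rewrite subn0; exists (eval_cost (state n) (Minus e (Get x (Const 0)))).+1.
        by apply: exec_while_false; rewrite guard subrr.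
      by rewrite ltnS eval_cost_le //; exact: stateV.
    have [t exect tm] := IHm (ltnW mn).
    have nm : (n - m = (n - m.+1).+1)%N by rewrite subnSK.
    have nmn : (n - m.+1 < n)%N by lia.
    have sm := stateV _ (ltnW nmn).
    have [sm' [t1 exec1 t1c]] := IH (state (n - m.+1)%N) wfc (safek _ nmn) sm.
    exists (eval_cost (state (n - m.+1)%N) (Minus e (Get x (Const 0))) +
      (t1 + (eval_cost (run c (state (n - m.+1)%N)) (Const 0) +
      eval_cost (run c (state (n - m.+1)%N))
        (Plus (Get x (Const 0)) (Const 1))).+1) + t).+1.
      apply: exec_while_true exect; first by rewrite guard; lia.
      by apply: exec_seq exec1 _; rewrite nm; exact: exec_store.
    have h1 := eval_cost_le (Minus e (Get x (Const 0))) sm.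
    have h2 := eval_cost_le (Const 0) sm'.
    have h3 := eval_cost_le (Plus (Get x (Const 0)) (Const 1)) sm'.
    rewrite mulSn; move: h1 h2 h3 tm; rewrite /test /step; lia.
  split; first exact: stateV.
  have [t exect tn] := while n (leqnn _).
  rewrite subnn in exect.
  exists ((eval_cost s (Const 0) + eval_cost s (Const 0)).+1 + t)%N.
    by apply: exec_seq exect; exact: exec_store.
  rewrite [code_cost _ _ _]/= -/test -/step; apply: leq_add.
    by rewrite ltnS leq_add // (eval_cost_le (Const 0) sV).
  by apply: leq_trans tn _; rewrite leq_add2r leq_mul2r eM orbT.
Qed.

Lemma polybounded_code_cost (V M : nat -> nat) (c : code) :
  polybounded V -> polybounded M ->
  polybounded (fun n => code_cost (V n) (M n) c).
Proof.
move=> pV pM.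
have add1 f : polybounded f -> polybounded (fun n => (f n).+1).
  move=> pf; have [T fT] := polyboundedD pf (polybounded_cst 1).
  by exists T => n; rewrite -addn1.
have bits e : polybounded (fun n => expr_bits (V n) e).
  elim: e => //= [z|e1 IH1 e2 IH2|e1 IH1 e2 IH2|e1 IH1 e2 IH2].
  - exact: polybounded_cst.
  - by apply: add1; apply: polyboundedD.
  - by apply: add1; apply: polyboundedD.
  - exact: polyboundedD.
have cost e : polybounded (fun n => expr_cost (V n) e).
  elim: e => [z|a e1 IH1|e1 IH1 e2 IH2|e1 IH1 e2 IH2|e1 IH1 e2 IH2
    |e1 IH1 e2 IH2].
  - exact: polyboundedD (add1 _ (bits (Const z))) (polybounded_cst 0).
  - exact: polyboundedD (add1 _ (bits (Get a e1))) IH1.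
  - exact: polyboundedD (add1 _ (bits (Plus e1 e2))) (polyboundedD IH1 IH2).
  - exact: polyboundedD (add1 _ (bits (Minus e1 e2))) (polyboundedD IH1 IH2).
  - exact: polyboundedD (add1 _ (bits (Times e1 e2))) (polyboundedD IH1 IH2).
  - exact: polyboundedD (add1 _ (bits (Quot e1 e2))) (polyboundedD IH1 IH2).
elim: c => [a e1 e2|c1 IH1 c2 IH2|x e c IH].
- exact: add1 _ (polyboundedD (cost e1) (cost e2)).
- exact: polyboundedD IH1 IH2.
- have test := add1 _ (cost (Minus e (Get x (Const 0)))).
  have step := add1 _ (polyboundedD (cost (Const 0))
    (cost (Plus (Get x (Const 0)) (Const 1)))).
  have init := add1 _ (polyboundedD (cost (Const 0)) (cost (Const 0))).
  exact: polyboundedD init (polyboundedD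
    (polyboundedM pM (polyboundedD (polyboundedD test IH) step)) test).
Qed.

(** * Coefficients of the adjugate of the characteristic matrix *)

Lemma deriv_bigprod (R : comNzRingType) (I : finType) (F : I -> {poly R}) :
  (\prod_i F i)^`() = \sum_i (F i)^`() * \prod_(j | i != j) F j.
Proof.
suff h (r : seq I) : uniq r -> (\prod_(i <- r) F i)^`() =
    \sum_(i <- r) (F i)^`() * \prod_(j <- r | i != j) F j.
  exact: h (index_enum_uniq I).
elim: r => [|i r IH] /=; first by rewrite !big_nil derivC.
move=> /andP[ir /IH {}IH]; rewrite !big_cons derivM IH eqxx /=.
have -> : \prod_(j <- r | i != j) F j = \prod_(j <- r) F j.
  rewrite big_seq_cond [RHS]big_seq_cond; apply: eq_bigl => j.
  by case: (boolP (j \in r)) => //= jr; apply: contraNneq ir => ->.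
congr (_ + _); rewrite big_distrr /= big_seq [RHS]big_seq.
apply: eq_bigr => j jr; rewrite big_cons.
by case: eqVneq jr ir => [->->//|_ _ _]; rewrite mulrCA.
Qed.

Section AdjugateCoefficients.
Variables (R : comNzRingType) (d : nat) (A : 'M[R]_d).

(** The coefficient of [X ^ k] in the adjugate of [X I - A]: these are the matrices of the
    Faddeev-LeVerrier recursion, which runs through them by decreasing [k]. *)
Definition adj_coef (k : nat) : 'M[R]_d :=
  \matrix_(i, j) (\adj (char_poly_mx A) i j)`_k.

Let c k := (char_poly A)`_k.

(** Jacobi's formula. In the Leibniz expansion only the diagonal entries of [X I - A] have a nonzero
    derivative, and differentiating the one at [i] leaves the sum over the permutations fixing [i],
    which is the cofactor. *)
Lemma tr_adj_char_poly_mx : \tr (\adj (char_poly_mx A)) = (char_poly A)^`().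
Proof.
rewrite /char_poly /determinant raddf_sum /=.
under [RHS]eq_bigr => s _.
  rewrite -(rmorph_sign polyC) deriv_mulC deriv_bigprod big_distrr /=; over.
rewrite exchange_big /=; apply: eq_bigr => i _.
rewrite mxE expand_cofactor [RHS](bigID (fun s : {perm 'I_d} => s i == i)) /=.
rewrite [X in _ + X]big1 ?addr0 => [|s si].
  apply: eq_bigr => s /eqP si; rewrite !mxE si eqxx derivB derivX derivC subr0.
  by rewrite mul1r rmorph_sign.
by rewrite !mxE eq_sym (negPf si) mulr0n sub0r derivN derivC oppr0 !(mul0r, mulr0).
Qed.

(** Comparison of the coefficients of [X ^ k.+1] in the identity of [X I - A] times its adjugate
    with the scalar matrix of the characteristic polynomial. *)
Lemma adj_coef_rec (k : nat) : adj_coef k = A *m adj_coef k.+1 + (c k.+1)%:M.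
Proof.
have := mul_mx_adj (char_poly_mx A); rewrite /adj_coef -/(char_poly A).
set B := \adj _; rewrite /char_poly_mx mulmxBl mul_scalar_mx => /matrixP h.
apply/matrixP => i j; move: {h}(congr1 (coefp k.+1) (h i j)).
rewrite /coefp /= !mxE coefB mulrC coefMX /= coef_sum coefMn => /eqP.
rewrite subr_eq addrC => /eqP ->; congr (_ + _).
by apply: eq_bigr => q _; rewrite !mxE coefCM.
Qed.

(** The coefficients vanish beyond some degree [m], and the recursion carries this down to [d],
    since the characteristic polynomial has no coefficient above [d]. *)
Lemma adj_coef_large (k : nat) : (d <= k)%N -> adj_coef k = 0.
Proof.
have [m Hm] : exists m, forall k, (m <= k)%N -> adj_coef k = 0.
  pose sz i j := size (\adj (char_poly_mx A) i j).
  exists (\max_i \max_j sz i j)%N => {}k mk.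
  apply/matrixP => i j; rewrite mxE [RHS]mxE nth_default //.
  apply: leq_trans mk.
  apply: leq_trans (leq_bigmax (F := fun i => \max_j sz i j)%N i).
  exact: (leq_bigmax (F := sz i)).
suff h e : forall k, (d <= k)%N -> (m <= e + k)%N -> adj_coef k = 0.
  by move=> dk; apply: (h (m - k)%N) => //; lia.
elim: e => [|e IH] {}k dk mk; first exact: Hm.
rewrite adj_coef_rec (IH k.+1) ?mulmx0 ?add0r; try lia.
by rewrite /c nth_default ?raddf0 // size_char_poly; lia.
Qed.

Lemma adj_coef_top : (0 < d)%N -> adj_coef d.-1 = 1%:M.
Proof.
move=> d0; rewrite adj_coef_rec prednK // adj_coef_large // mulmx0 add0r /c.
by have /monicP := char_poly_monic A; rewrite lead_coefE size_char_poly => ->.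
Qed.

Lemma adj_coef0 : adj_coef 0 = \adj (- A).
Proof.
have -> : - A = map_mx (horner_eval 0) (char_poly_mx A).
  apply/matrixP => i j; rewrite !mxE /horner_eval hornerD hornerN hornerMn.
  by rewrite hornerX hornerC mul0rn sub0r.
rewrite -map_mx_adj; apply/matrixP => i j.
by rewrite mxE [RHS]mxE /= /horner_eval horner_coef0.
Qed.

Lemma tr_adj_coef (k : nat) : \tr (adj_coef k) = c k.+1 *+ k.+1.
Proof.
rewrite -coef_deriv -tr_adj_char_poly_mx coef_sum.
by apply: eq_bigr => i _; rewrite mxE.
Qed.

(** The trace of [adj_coef_rec] combined with Jacobi's formula. For [k.+1 < d] it recovers the
    coefficient [c k.+1] from a product already computed, by an exact division. *)
Lemma tr_mul_adj_coef (k : nat) :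
  (k < d)%N -> \tr (A *m adj_coef k.+1) = - (c k.+1 *+ (d - k.+1)).
Proof.
move=> kd; have /(congr1 mxtrace) := adj_coef_rec k.
rewrite raddfD /= tr_adj_coef mxtrace_scalar => /esym/(canRL (addrK _)) ->.
by rewrite mulrnBr // opprB.
Qed.

End AdjugateCoefficients.

(** One step multiplies the bound by [d * D] for the product and by [d * (d * D)] for its trace. The
    trace is a nonzero integer multiple of the coefficient, which is therefore no larger; the sum is
    at most [2 * d ^ 2 * D] times the old bound. *)
Lemma adj_coef_bound (d : nat) (A : 'M[int]_d) (D : int) (y : nat) :
  (0 < d)%N -> (forall i j, `|A i j| <= D) -> (y < d)%N ->
  forall i j, `|adj_coef A (d.-1 - y) i j| <= (2 * d%:Z ^+ 2 * D) ^+ y.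
Proof.
move=> d0 AD; elim: y => [_|y IH yd] i j.
  by rewrite subn0 adj_coef_top // mxE expr0; case: eqP.
have ky : (d.-1 - y = (d.-1 - y.+1).+1)%N by lia.
have D0 : 0 <= D by apply: le_trans (AD i j).
set k := (d.-1 - y.+1)%N in ky *; set m := (2 * d%:Z ^+ 2 * D) ^+ y in IH *.
have prod_le i' j' : `|(A *m adj_coef A k.+1) i' j'| <= d%:Z * (D * m).
  rewrite mxE; apply: le_trans (ler_norm_sum _ _ _) _.
  rewrite -[X in X%:Z * _]card_ord -sum1_card -natz natr_sum mulr_suml.
  apply: ler_sum => q _; rewrite mul1r normrM ler_pM //.
  by rewrite -ky; apply: IH; lia.
have m0 : 0 <= m by rewrite exprn_ge0 // mulr_ge0 // mulr_ge0 // exprn_ge0.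
have coef_le : `|(char_poly A)`_k.+1| <= d%:Z * (d%:Z * (D * m)).
  have : `|\tr (A *m adj_coef A k.+1)| <= d%:Z * (d%:Z * (D * m)).
    apply: le_trans (ler_norm_sum _ _ _) _.
    rewrite -[X in X%:Z * _]card_ord -sum1_card -natz natr_sum mulr_suml.
    by apply: ler_sum => q _; rewrite mul1r.
  rewrite tr_mul_adj_coef; last lia.
  rewrite normrN normrMn; apply: le_trans.
  by rewrite -[leLHS]mulr1n ler_wpMn2l //; lia.
rewrite adj_coef_rec mxE; apply: le_trans (ler_normD _ _) _.
apply: (@le_trans _ _ (d%:Z * (D * m) + d%:Z * (d%:Z * (D * m)))).
  apply: lerD (prod_le _ _) _; rewrite mxE; case: eqP => _; rewrite ?mulr1n //.
  by rewrite mulr0n normr0 (le_trans _ coef_le).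
rewrite exprS -/m.
have d1 : 1 <= d%:Z by lia.
have Dm : 0 <= D * m by rewrite mulr_ge0.
nia.
Qed.

(** * Powers of irreducible stochastic matrices *)

Section StochasticPowers.
Variables (R : realFieldType) (d : nat) (P : 'M[R]_d).
Hypothesis stochP : stochastic P.

Lemma stochastic_exp (m : nat) : stochastic (P ^+ m).
Proof.
have [P0 P1] := stochP; elim: m => [|m [IH0 IH1]].
  split=> [i j|j]; first by rewrite expr0 mxE; case: eqP.
  under eq_bigr do rewrite expr0 mxE.
  by rewrite (bigD1 j) //= eqxx big1 ?addr0 // => i /negPf ->.
split=> [i j|j].
  by rewrite exprS -mulmxE mxE sumr_ge0 // => k _; rewrite mulr_ge0.
under eq_bigr do rewrite exprS -mulmxE mxE.
rewrite exchange_big -[RHS](IH1 j); apply: eq_bigr => k _ /=.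
by rewrite -mulr_suml P1 mul1r.
Qed.

Lemma stochastic_exp_le1 (m : nat) (i j : 'I_d) : (P ^+ m) i j <= 1.
Proof.
have [P0 P1] := stochastic_exp m.
by rewrite -(P1 j) (bigD1 i) //= lerDl sumr_ge0.
Qed.

(** The walk goes from [j] to [i], following the column convention. *)
Definition walk (m : nat) (i j : 'I_d) : bool := 0 < (P ^+ m) i j.

Lemma walkDP (a b : nat) (i j : 'I_d) :
  reflect (exists2 k, walk a i k & walk b k j) (walk (a + b)%N i j).
Proof.
have [[a0 _] [b0 _]] := (stochastic_exp a, stochastic_exp b).
have ab0 k : 0 <= (P ^+ a) i k * (P ^+ b) k j by rewrite mulr_ge0.
rewrite [walk (_ + _)%N _ _]/walk exprD -mulmxE mxE; apply: (iffP idP) => [s0|[k ak bk]].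
  have /hasP[k _ kP] : has (fun k => 0 < (P ^+ a) i k * (P ^+ b) k j) (index_enum 'I_d).
    apply: contraLR s0 => /hasPn h; rewrite -leNgt big1 // => k _.
    by apply/eqP; rewrite eq_le ab0 leNgt h // mem_index_enum.
  exists k; rewrite /walk lt0r ?a0 ?b0 andbT; apply: contraTneq kP => ->.
    by rewrite mul0r ltxx.
  by rewrite mulr0 ltxx.
rewrite (bigD1 k) //= ltr_wpDr ?sumr_ge0 //.
exact: mulr_gt0.
Qed.

Lemma walkD (a b : nat) (k i j : 'I_d) : walk a i k -> walk b k j -> walk (a + b)%N i j.
Proof. by move=> ? ?; apply/walkDP; exists k. Qed.

Lemma walk0 (i : 'I_d) : walk 0 i i.
Proof. by rewrite /walk expr0 mxE eqxx ltr01. Qed.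

Lemma walkM (m k : nat) (i : 'I_d) : walk m i i -> walk (k * m)%N i i.
Proof.
by move=> h; elim: k => [|k IH]; [exact: walk0|rewrite mulSn; exact: walkD IH].
Qed.

Lemma walk_from (m : nat) (j : 'I_d) : exists i, walk m i j.
Proof.
have [P0 P1] := stochastic_exp m.
have /hasP[i _ ?] : has (fun i => walk m i j) (index_enum 'I_d); last by exists i.
apply: contraT => /hasPn h; have := P1 j; rewrite big1 => [/eqP|i _].
  by rewrite eq_sym oner_eq0.
by apply/eqP; rewrite eq_le P0 leNgt h // mem_index_enum.
Qed.

Lemma walk_irreducible (i j : 'I_d) : irreducible_chain P -> exists m, walk m i j.
Proof.
move=> /(_ j i) /connectP[p pth ->]; elim: p j pth => [|k p IH] j /=.
  by exists 0%N; exact: walk0.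
move=> /andP[jk /IH[m km]]; exists (m + 1)%N; apply: walkD km _.
by rewrite /walk expr1.
Qed.

Definition pattern (m : nat) : 'M[bool]_d := \matrix_(i, j) walk m i j.

Lemma patternP (a b : nat) : pattern a = pattern b <-> walk a =2 walk b.
Proof.
split=> [/matrixP h i j|h]; first by have := h i j; rewrite !mxE.
by apply/matrixP => i j; rewrite !mxE h.
Qed.

Lemma patternD (a b c : nat) :
  pattern a = pattern b -> pattern (c + a)%N = pattern (c + b)%N.
Proof.
rewrite !patternP => h i j.
by apply/walkDP/walkDP => -[k ? ?]; exists k; rewrite // ?h // -h.
Qed.

Lemma pattern_recurrent :
  exists2 L, (0 < L)%N & pattern (2 ^ (d * d) + L)%N = pattern (2 ^ (d * d))%N.
Proof.
set N := (2 ^ (d * d))%N.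
have /injectivePn[a [b ab pab]] : ~~ injectiveb (fun m : 'I_N.+1 => pattern m).
  apply/negP => /injectiveP/leq_card; rewrite card_ord card_mx card_bool.
  by rewrite ltnn.
wlog {ab} ab : a b pab / (a < b)%N.
  move=> h; have [lab|lba|/val_inj eab] := ltngtP a b.
  - exact: h pab lab.
  - exact: h (esym pab) lba.
  - by rewrite eab eqxx in ab.
exists (b - a)%N; first by rewrite subn_gt0.
(* Adding [N - a] to both exponents makes the repetition start exactly at [N]. *)
have := patternD (N - a) (esym pab).
have aN : (a <= N)%N by rewrite -ltnS.
by rewrite subnK // (_ : N - a + b = N + (b - a))%N //; lia.
Qed.

End StochasticPowers.

(** Here [G = F + (1 - e) (H - F)], where [F] and [H - F] annihilate each other; powers are taken
    separately, and those of [H - F] are [H ^+ n - F]. *)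
Lemma exp_convex_idempotent (R : comNzRingType) (d : nat) (G F H : 'M[R]_d)
    (e : R) (n : nat) :
  G = e *: F + (1 - e) *: H -> F *m F = F -> H *m F = F -> F *m H = F ->
  G ^+ n.+1 = F + (1 - e) ^+ n.+1 *: (H ^+ n.+1 - F).
Proof.
move=> GE FF HF FH.
have HnF m : H ^+ m *m F = F.
  elim: m => [|m IH]; first by rewrite expr0 mul1mx.
  by rewrite exprSr -mulmxE -mulmxA HF.
elim: n => [|n IH]; first by rewrite !expr1 GE; apply/matrixP => i j; rewrite !mxE; ring.
rewrite exprSr {}IH GE [H ^+ n.+2]exprSr -!mulmxE mulmxDl -scalemxAl mulmxBl !mulmxDr.
rewrite -!scalemxAr FF FH HnF [_ ^+ n.+2]exprSr; apply/matrixP => i j; rewrite !mxE; ring.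
Qed.

(** * Periodicity of the walks and geometric convergence to the cyclic limit *)

Section CyclicStructure.
Variables (R : realFieldType) (d : nat) (P : 'M[R]_d) (N L : nat).
Hypotheses (stochP : stochastic P) (irrP : irreducible_chain P).
Hypotheses (L_gt0 : (0 < L)%N) (pattern_L : pattern P (N + L)%N = pattern P N).
Hypothesis L_min :
  forall k, (0 < k < L)%N -> pattern P (N + k)%N <> pattern P N.

Lemma walk_periodic (m c : nat) (i j : 'I_d) :
  (N <= m)%N -> walk P (m + c * L)%N i j = walk P m i j.
Proof.
move=> Nm; move: i j; apply/patternP.
elim: c => [|c IH]; first by rewrite addn0.
rewrite -{}IH mulSn (_ : m + _ = m - N + c * L + (N + L))%N; last lia.
by rewrite (patternD stochP _ pattern_L); congr pattern; lia.
Qed.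

(* A walk through j can use a closed walk of length a + r or b + r there; L
   detours, all but one of the first kind, have length b - a modulo L. *)
Lemma walk_detour (a b m : nat) (i j x y : 'I_d) :
  (N <= m)%N -> walk P a i j -> walk P b i j -> walk P m x y ->
  walk P (m + (L.-1 * a + b))%N x y.
Proof.
move=> Nm wa wb wm.
have [u yj] := walk_irreducible stochP j y irrP.
have [v jy] := walk_irreducible stochP y j irrP.
have [r ij] := walk_irreducible stochP j i irrP.
have ya : walk P (v + (r + a) + u)%N y y.
  exact: (walkD stochP (walkD stochP jy (walkD stochP ij wa)) yj).
have yb : walk P (v + (r + b) + u)%N y y.
  exact: (walkD stochP (walkD stochP jy (walkD stochP ij wb)) yj).
have := walkD stochP wm (walkD stochP (walkM stochP L.-1 ya) yb).
rewrite (_ : m + _ = m + (L.-1 * a + b) + (u + v + r) * L)%N; last first.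
  have -> : ((u + v + r) * L = (u + v + r) * L.-1 + (u + v + r))%N.
    by rewrite -{1}(prednK L_gt0) mulnS addnC.
  by lia.
by rewrite walk_periodic // (leq_trans Nm) ?leq_addr.
Qed.

(** The number [e] is [b - a] modulo [L]. Detours show that the pattern at [N + e] contains the one
    at [N]; once the two are equal, [e %% L] would be a period below [L] unless it is 0. *)
Lemma walk_congr (a b : nat) (i j : 'I_d) :
  walk P a i j -> walk P b i j -> a = b %[mod L].
Proof.
move=> wa wb; set e := (L.-1 * a + b)%N.
have iter c m x y : (N <= m)%N -> walk P m x y -> walk P (m + c * e)%N x y.
  move=> Nm wm; elim: c => [|c IH]; first by rewrite addn0.
  rewrite mulSn addnCA addnC; apply: walk_detour wa wb IH.
  by rewrite (leq_trans Nm) ?leq_addr.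
have eN : pattern P (N + e)%N = pattern P N.
  apply/patternP => x y; apply/idP/idP => w.
    (* From [N + e], another [L.-1] detours lead to [N + L * e], where the pattern is that of [N]
       again: the inclusion is an equality. *)
    have := iter L.-1 _ _ _ (leq_addr e N) w.
    rewrite -addnA -mulSn prednK // mulnC walk_periodic //.
  by have := iter 1%N _ _ _ (leqnn N) w; rewrite mul1n.
have eL : (e %% L = 0)%N.
  have [//|e0] := posnP (e %% L)%N.
  case: (L_min (k := (e %% L)%N)); first by rewrite e0 ltn_mod.
  rewrite -eN; apply/patternP => x y.
  rewrite [X in _ = walk P X x y](_ : _ = N + e %% L + e %/ L * L)%N.
    by rewrite walk_periodic // leq_addr.
  by rewrite {1}(divn_eq e L); lia.
apply/eqP; rewrite -(eqn_modDl (L.-1 * a)) -/e -mulSnr prednK //.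
by rewrite eL mulnC modnMl.
Qed.

(** A walk of length [m] from [j] ends somewhere, because columns sum to 1, and irreducibility
    continues it to [i]; the extra length is then reduced modulo [L]. *)
Lemma walk_exists (m : nat) (i j : 'I_d) :
  (N <= m)%N -> exists2 k, (k < L)%N & walk P (m + k)%N i j.
Proof.
move=> Nm; have [q mj] := walk_from stochP m j.
have [r iq] := walk_irreducible stochP i q irrP.
exists (r %% L)%N; first by rewrite ltn_mod.
have := walkD stochP iq mj.
rewrite (_ : r + m = m + r %% L + r %/ L * L)%N.
  by rewrite walk_periodic // (leq_trans Nm) ?leq_addr.
by rewrite {1}(divn_eq r L); lia.
Qed.

(** Only the left-to-right direction needs the cyclic structure: some walk of length [m + q] with
    [q < L] leads from [j] to [k], and after its extension to [i] uniqueness of the residue forces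
    [q = 0]. *)
Lemma walk_stepl (c m : nat) (i j k : 'I_d) :
  (N <= m)%N -> walk P c i k -> walk P (c + m)%N i j = walk P m k j.
Proof.
move=> Nm wc; apply/idP/idP => [w|]; last exact: walkD.
have [q qL wq] := walk_exists k j Nm.
have /eqP := walk_congr w (walkD stochP wc wq).
rewrite addnA -{1}[(c + m)%N]addn0 eqn_modDl mod0n modn_small // => /eqP q0.
by rewrite -q0 addn0 in wq.
Qed.

Lemma walk_stepr (c m : nat) (i j k : 'I_d) :
  (N <= m)%N -> walk P c k j -> walk P (m + c)%N i j = walk P m i k.
Proof.
move=> Nm wc; apply/idP/idP => [w|w]; last exact: walkD w wc.
have [q qL wq] := walk_exists i k Nm.
have /eqP := walk_congr w (walkD stochP wq wc).
rewrite addnAC -{1}[(m + c)%N]addn0 eqn_modDl mod0n modn_small // => /eqP q0.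
by rewrite -q0 addn0 in wq.
Qed.

(** Walks from a fixed state of lengths [N + k] with [k < L] have pairwise distinct ends, as equal
    ends would make the lengths congruent modulo [L]. *)
Lemma period_le_dim : (0 < d)%N -> (L <= d)%N.
Proof.
move=> d_gt0; pose j : 'I_d := Ordinal d_gt0.
have [f fP] : exists f : 'I_L -> 'I_d, forall k : 'I_L, walk P (N + k)%N (f k) j.
  have h (k : 'I_L) := cid (walk_from stochP (N + k)%N j).
  by exists (fun k : 'I_L => sval (h k)) => k; exact: svalP (h k).
rewrite -[L]card_ord -[d]card_ord; apply: (leq_card f) => k1 k2 fk.
have := fP k1; rewrite fk => /walk_congr - /(_ _ (fP k2)) /eqP.
by rewrite eqn_modDl !modn_small // => /eqP/val_inj.
Qed.

Variables (alpha : 'I_d -> R).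
Hypotheses (alpha_gt0 : forall i, 0 < alpha i) (alpha_sum : \sum_i alpha i = 1).
Hypothesis alpha_stationary : forall i, \sum_j P i j * alpha j = alpha i.

(* For m >= N this is the periodic sequence to which P ^+ m is asymptotic. *)
Definition cyclic_limit (m : nat) : 'M[R]_d :=
  \matrix_(i, j) (if walk P m i j then L%:R * alpha i else 0).

Local Notation E := cyclic_limit.

Lemma cyclic_limit_periodic (m c : nat) : (N <= m)%N -> E (m + c * L)%N = E m.
Proof. by move=> Nm; apply/matrixP => i j; rewrite !mxE walk_periodic. Qed.

Lemma cyclic_limit_ge0 (m : nat) (i j : 'I_d) : 0 <= E m i j.
Proof. by rewrite mxE; case: ifP => // _; rewrite mulr_ge0 // ltW. Qed.

Lemma stochastic_walk1 (i j : 'I_d) : P i j = if walk P 1 i j then P i j else 0.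
Proof.
rewrite /walk expr1; case: ltP => // Pij; apply/eqP.
by rewrite eq_le Pij stochP.1.
Qed.

(** By [walk_stepl] all [k] with [P i k] positive share the same indicator [walk P m.+1 i j]; it
    factors out and leaves the stationarity of [alpha]. *)
Lemma mul_cyclic_limit (m : nat) : (N <= m)%N -> P *m E m = E m.+1.
Proof.
move=> Nm; apply/matrixP => i j; rewrite !mxE.
transitivity (\sum_k P i k * (L%:R * alpha k) *+ walk P m.+1 i j).
  apply: eq_bigr => k _; rewrite mxE [P i k]stochastic_walk1.
  case: ifP => [w|_]; last by rewrite !mul0r mul0rn.
  by rewrite -add1n (walk_stepl _ Nm w); case: (walk P m k j); rewrite ?mulr0.
case: (walk P m.+1 i j); last by rewrite big1.
by under eq_bigr do rewrite mulr1n mulrCA; rewrite -mulr_sumr alpha_stationary.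
Qed.

Lemma cyclic_limit_mul (m : nat) : (N <= m)%N -> E m *m P = E m.+1.
Proof.
move=> Nm; apply/matrixP => i j; rewrite !mxE.
transitivity (\sum_k (if walk P m.+1 i j then L%:R * alpha i else 0) * P k j).
  apply: eq_bigr => k _; rewrite mxE [P k j]stochastic_walk1.
  case: (boolP (walk P 1 k j)) => [w|_]; last by rewrite !mulr0.
  by rewrite -addn1 (walk_stepr _ Nm w).
by rewrite -mulr_sumr stochP.2 mulr1.
Qed.

Lemma mul_exp_cyclic_limit (c m : nat) : (N <= m)%N -> P ^+ c *m E m = E (c + m)%N.
Proof.
move=> Nm; elim: c => [|c IH]; first by rewrite expr0 mul1mx.
rewrite exprS -mulmxE -mulmxA IH mul_cyclic_limit //.
by rewrite (leq_trans Nm) ?leq_addl.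
Qed.

Lemma cyclic_limit_mul_exp (c m : nat) : (N <= m)%N -> E m *m P ^+ c = E (m + c)%N.
Proof.
move=> Nm; elim: c => [|c IH]; first by rewrite expr0 mulmx1 addn0.
rewrite exprSr -mulmxE mulmxA IH cyclic_limit_mul ?addnS //.
by rewrite (leq_trans Nm) ?leq_addr.
Qed.

Lemma cyclic_limit_sum_period (m : nat) (i j : 'I_d) :
  (N <= m)%N -> \sum_(k < L) E (m + k)%N i j = L%:R * alpha i.
Proof.
move=> Nm; have [q qL wq] := walk_exists i j Nm.
rewrite (bigD1 (Ordinal qL)) //= mxE wq big1 ?addr0 // => k kq.
rewrite mxE; case: ifP => // /(walk_congr wq)/eqP.
rewrite eqn_modDl !modn_small // => /eqP qk.
by case/eqP: kq; apply: val_inj.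
Qed.

(** Left multiplication by powers of [P] preserves column sums, so the sum does not depend on [m];
    over one period these sums add up to [L]. *)
Lemma cyclic_limit_colsum (m : nat) (j : 'I_d) :
  (N <= m)%N -> \sum_i E m i j = 1.
Proof.
move=> Nm; have step k : \sum_i E (m + k)%N i j = \sum_i E m i j.
  rewrite addnC -mul_exp_cyclic_limit //.
  under eq_bigr do rewrite mxE; rewrite exchange_big /=.
  by apply: eq_bigr => q _; rewrite -mulr_suml (stochastic_exp stochP k).2 mul1r.
have L0 : L%:R != 0 :> R by rewrite pnatr_eq0 -lt0n.
apply: (mulfI L0); rewrite mulr1.
have <- : \sum_(k < L) \sum_i E (m + k)%N i j = L%:R * \sum_i E m i j.
  by under eq_bigr do rewrite step; rewrite sumr_const card_ord mulr_natl.
rewrite exchange_big /=; under eq_bigr do rewrite cyclic_limit_sum_period //.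
by rewrite -mulr_sumr alpha_sum mulr1.
Qed.

(** When the entry at [k, j] is nonzero, the entries at [i, k] and [i, j] coincide, by [walk_stepr]
    and because the exponent is a multiple of [L]. The common value factors out of a column sum
    equal to 1. *)
Lemma cyclic_limit_idem (c : nat) :
  (N <= c * L)%N -> E (c * L)%N *m E (c * L)%N = E (c * L)%N.
Proof.
move=> NM; apply/matrixP => i j; rewrite mxE.
transitivity (\sum_k E (c * L)%N i j * E (c * L)%N k j).
  apply: eq_bigr => k _; rewrite ![E _ _ _]mxE.
  have [w|_] := boolP (walk P (c * L)%N k j); last by rewrite !mulr0.
  by have := walk_stepr i NM w; rewrite walk_periodic // => ->.
by rewrite -mulr_sumr cyclic_limit_colsum // mulr1.
Qed.

Lemma exp_cyclic_limit_minor (M : nat) : (N <= M)%N ->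
  exists2 e : R, 0 < e < 1 & forall i j, e * E M i j <= (P ^+ M) i j.
Proof.
move=> NM; have [G0 _] := stochastic_exp stochP M.
(* The reciprocal of a sum of reciprocals lies below every positive entry and so replaces a minimum.
   The default value 1 keeps [f] positive, and the summand 2 makes the result smaller than 1. *)
pose f (p : 'I_d * 'I_d) := if walk P M p.1 p.2 then (P ^+ M) p.1 p.2 else 1.
have f0 p : 0 < f p by rewrite /f; case: ifP => // _; exact: ltr01.
have s0 : 0 <= \sum_p (f p)^-1 by rewrite sumr_ge0 // => p _; rewrite invr_ge0 ltW.
have t0 : 0 < 2 + \sum_p (f p)^-1 by rewrite ltr_wpDr // ltr0n.
exists (2 + \sum_p (f p)^-1)^-1.
  rewrite invr_gt0 t0 invf_lt1 //= (lt_le_trans (y := 2)) ?ltr1n // lerDl //.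
move=> i j; have [w|] := boolP (walk P M i j); last first.
  by move=> /negPf w; rewrite [E _ _ _]mxE w mulr0.
have E1 : E M i j <= 1.
  rewrite -(cyclic_limit_colsum j NM) (bigD1 i) //= lerDl sumr_ge0 // => k _.
  exact: cyclic_limit_ge0.
apply: (@le_trans _ _ (2 + \sum_p (f p)^-1)^-1).
  by rewrite ler_piMr // invr_ge0 ltW.
have fij : (P ^+ M) i j = f (i, j) by rewrite /f w.
rewrite fij -[leRHS]invrK lef_pV2 ?posrE ?invr_gt0 //.
rewrite (bigD1 (i, j)) //= addrCA lerDl addr_ge0 // sumr_ge0 // => p _.
by rewrite invr_ge0 ltW.
Qed.

(** Doeblin's argument: [P ^+ M] is a convex combination of the idempotent [E M] and a stochastic
    matrix [H] that [E M] absorbs on both sides. The bound is uniform in the remainder [r], which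
    only multiplies by the stochastic matrix [P ^+ r]. *)
Lemma exp_cyclic_limit_geometric : exists (M : nat) (c : R),
  [/\ (0 < M)%N, 0 < c < 1 & forall q r i j,
    `|(P ^+ (q.+1 * M + r)) i j - E (q.+1 * M + r)%N i j| <= d%:R * c ^+ q.+1].
Proof.
(* A multiple of [L], for idempotence, that is at least [N]. *)
pose M := (N.+1 * L)%N; have NM : (N <= M)%N by rewrite ltnW // leq_pmulr.
have [e /andP[e0 e1] eE] := exp_cyclic_limit_minor NM.
have c0 : 0 < 1 - e by rewrite subr_gt0.
exists M, (1 - e); split; first by rewrite muln_gt0.
  by rewrite c0 ltrBlDr ltrDl.
pose H := (1 - e)^-1 *: (P ^+ M - e *: E M).
have GH : P ^+ M = e *: E M + (1 - e) *: H.
  by rewrite scalerA divff ?lt0r_neq0 // scale1r addrC subrK.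
have stochH : stochastic H.
  have HijE i j : H i j = (1 - e)^-1 * ((P ^+ M) i j - e * E M i j).
    rewrite [LHS]mxE; congr (_ * _); rewrite [LHS]mxE; congr (_ + _).
    by rewrite [LHS]mxE; congr (- _); rewrite [LHS]mxE.
  split=> [i j|j]; first by rewrite HijE mulr_ge0 ?invr_ge0 ?(ltW c0) // subr_ge0.
  under eq_bigr do rewrite HijE.
  rewrite -mulr_sumr sumrB -mulr_sumr cyclic_limit_colsum //.
  by rewrite (stochastic_exp stochP M).2 mulr1 mulVf // lt0r_neq0.
have EE : E M *m E M = E M by exact: cyclic_limit_idem.
have GE : P ^+ M *m E M = E M by rewrite mul_exp_cyclic_limit // cyclic_limit_periodic.
have EG : E M *m P ^+ M = E M by rewrite cyclic_limit_mul_exp // cyclic_limit_periodic.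
have Ee : E M - e *: E M = (1 - e) *: E M by rewrite scalerBl scale1r.
have HE : H *m E M = E M.
  rewrite -scalemxAl mulmxBl -scalemxAl GE EE Ee.
  by rewrite scalerA mulVf ?scale1r // lt0r_neq0.
have EH : E M *m H = E M.
  rewrite -scalemxAr mulmxBr -scalemxAr EG EE Ee.
  by rewrite scalerA mulVf ?scale1r // lt0r_neq0.
have Gn n : P ^+ (n.+1 * M) = E M + (1 - e) ^+ n.+1 *: (H ^+ n.+1 - E M).
  by rewrite mulnC exprM; apply: exp_convex_idempotent GH EE HE EH.
move=> q r i j.
have -> : E (q.+1 * M + r)%N = E (r + M)%N.
  rewrite mulSn (_ : M + q * M + r = r + M + q * N.+1 * L)%N; last by rewrite /M; lia.
  by rewrite cyclic_limit_periodic // (leq_trans NM) ?leq_addl.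
rewrite -mul_exp_cyclic_limit // addnC exprD -mulmxE Gn mulmxDr.
rewrite [(P ^+ r *m E M + _) i j]mxE addrAC subrr add0r -scalemxAr.
rewrite [X in `|X|]mxE normrM.
rewrite ger0_norm ?exprn_ge0 ?(ltW c0) // mulrC ler_wpM2r ?exprn_ge0 ?(ltW c0) //.
rewrite mxE; apply: le_trans (ler_norm_sum _ _ _) _.
have -> : d%:R = \sum_(k < d) (1 : R) by rewrite sumr_const card_ord.
apply: ler_sum => k _.
have [r0 _] := stochastic_exp stochP r; have [H0 _] := stochastic_exp stochH q.+1.
rewrite normrM mulr_ile1 //; first by rewrite ger0_norm // stochastic_exp_le1.
have E0 := cyclic_limit_ge0 M k j.
have E1 : E M k j <= 1.
  rewrite -(cyclic_limit_colsum j NM) (bigD1 k) //= lerDl sumr_ge0 // => l _.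
  exact: cyclic_limit_ge0.
have H1 := stochastic_exp_le1 stochH q.+1 k j; have := H0 k j.
rewrite mxE [X in _ + X]mxE; move: (E M k j) (_ k j) E0 E1 H1 => a b a0 a1 b1 b0.
by rewrite ler_norml; apply/andP; split; lra.
Qed.

End CyclicStructure.

(** * Stationary vectors *)

Section StationaryVector.
Variables (R : realFieldType) (d : nat) (P : 'M[R]_d).
Hypotheses (stochP : stochastic P) (irrP : irreducible_chain P).

Lemma stationary_exp (v : 'I_d -> R) (m : nat) :
  (forall i, \sum_j P i j * v j = v i) ->
  forall i, \sum_j (P ^+ m) i j * v j = v i.
Proof.
move=> Pv; pose V := \col_i v i.
have PV : P *m V = V.
  by apply/matrixP => i j; rewrite !mxE -[RHS]Pv; apply: eq_bigr => k _; rewrite mxE.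
have PmV : P ^+ m *m V = V.
  by elim: m => [|m IH]; rewrite ?expr0 ?mul1mx // exprSr -mulmxE -mulmxA PV.
move=> i; have /matrixP/(_ i 0) := PmV; rewrite !mxE => <-.
by apply: eq_bigr => k _; rewrite mxE.
Qed.

(** If [v i] were 0, stationarity under [P ^+ m], for a walk of length [m] from [i0] to [i], would
    force [v i0 = 0]. *)
Lemma nonneg_stationary_gt0 (v : 'I_d -> R) (i0 : 'I_d) :
  (forall i, 0 <= v i) -> (forall i, \sum_j P i j * v j = v i) ->
  v i0 != 0 -> forall i, 0 < v i.
Proof.
move=> v0 Pv vi0 i; rewrite lt0r v0 andbT; apply: contra vi0 => /eqP vi.
have [m w] := walk_irreducible stochP i i0 irrP.
have [P0 _] := stochastic_exp stochP m.
have /psumr_eq0P/(_ i0 isT)/eqP : \sum_j (P ^+ m) i j * v j = 0 by rewrite stationary_exp.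
by rewrite mulf_eq0 gt_eqF //= => ->// k _; rewrite mulr_ge0.
Qed.

(** The triangle inequality gives one inequality in each coordinate; both sides have the same total,
    since columns sum to 1, so all are equalities. *)
Lemma abs_stationary (v : 'I_d -> R) :
  (forall i, \sum_j P i j * v j = v i) ->
  forall i, \sum_j P i j * `|v j| = `|v i|.
Proof.
move=> Pv i; have [P0 P1] := stochP.
have le k : `|v k| <= \sum_j P k j * `|v j|.
  rewrite -{1}Pv; apply: le_trans (ler_norm_sum _ _ _) _.
  by apply: ler_sum => j _; rewrite normrM ger0_norm.
apply/eqP; rewrite -subr_eq0; apply/eqP.
apply: (psumr_eq0P (P := xpredT) (F := fun k => \sum_j P k j * `|v j| - `|v k|)) => //.
  by move=> k _; rewrite subr_ge0.
rewrite sumrB exchange_big /=; apply/eqP; rewrite subr_eq0; apply/eqP.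
by apply: eq_bigr => j _; rewrite -mulr_suml P1 mul1r.
Qed.

(** Up to sign [v i0] is positive. Then [v + |v|] is a non-negative stationary vector, nonzero at
    [i0], hence positive everywhere, which excludes [v i <= 0]. *)
Lemma stationary_normalized_gt0 (v : 'I_d -> R) (i0 : 'I_d) :
  (forall i, \sum_j P i j * v j = v i) -> v i0 != 0 ->
  \sum_i v i != 0 /\ forall i, 0 < v i / \sum_j v j.
Proof.
wlog vi0 : v / 0 < v i0.
  move=> th Pv; rewrite neq_lt => /orP[vn|vp]; last by apply: th; rewrite // gt_eqF.
  have [] := th (fun i => - v i).
  - by rewrite oppr_gt0.
  - by move=> i; under eq_bigr do rewrite mulrN; rewrite sumrN Pv.
  - by rewrite oppr_eq0 lt_eqF.
  rewrite sumrN oppr_eq0 => s0 h; split=> // i.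
  by have := h i; rewrite invrN mulrNN.
move=> Pv _; have v0 : forall i, 0 < v i.
  have h : forall i, 0 < v i + `|v i|.
    move=> k.
    apply: (nonneg_stationary_gt0 (v := fun i => v i + `|v i|) (i0 := i0)) => [i|i|].
    - by have := ler_norm (- v i); rewrite normrN; lra.
    - under eq_bigr do rewrite mulrDr.
      by rewrite big_split /= Pv abs_stationary.
    - by rewrite gt_eqF // ltr_wpDr.
  by move=> i; have := h i; case: (ltP 0 (v i)) => // vi; rewrite ler0_norm // subrr ltxx.
have s0 : 0 < \sum_i v i.
  by rewrite (bigD1 i0) //= ltr_wpDr // sumr_ge0 // => i _; exact: ltW.
by split=> [|i]; rewrite ?gt_eqF // divr_gt0.
Qed.

(** Outside [j0], [u j] is the average of [u] over the successors of [j], so a maximum of [|u|]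
    spreads to all of them. Along a path to [j0] it reaches the value 0. *)
Lemma max_principle (u : 'I_d -> R) (j0 : 'I_d) :
  u j0 = 0 -> (forall j, j != j0 -> \sum_i u i * P i j = u j) -> forall i, u i = 0.
Proof.
move=> uj0 uP i; have [P0 P1] := stochP.
have [k umax] : exists k, forall q, `|u q| <= `|u k|.
  by exists [arg max_(k > j0) `|u k|]%O => q; case: arg_maxP => // k _; exact.
suff uk : `|u k| = 0 by have := umax i; rewrite uk normr_le0 => /eqP.
apply/eqP; apply: contraT => uk0.
have step j q : `|u j| = `|u k| -> transition P j q -> `|u q| = `|u k|.
  move=> uj jq; have jj0 : j != j0.
    by apply: contraNneq uk0 => jj0; rewrite -uj jj0 uj0 normr0.
  have s0 : \sum_i (`|u k| - `|u i|) * P i j = 0.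
    apply/eqP; rewrite eq_le; apply/andP; split; last first.
      by rewrite sumr_ge0 // => p _; rewrite mulr_ge0 // subr_ge0.
    under eq_bigr do rewrite mulrBl.
    rewrite sumrB -mulr_sumr P1 mulr1 subr_le0 -uj -(uP j jj0).
    apply: le_trans (ler_norm_sum _ _ _) _.
    by apply: ler_sum => p _; rewrite normrM [`|P _ _|]ger0_norm.
  have /psumr_eq0P/(_ q isT)/eqP := s0.
  rewrite mulf_eq0 subr_eq0 (gt_eqF jq) orbF => h; apply/esym/eqP/h => p _.
  by rewrite mulr_ge0 // subr_ge0.
have /connectP[p pth ej0] := irrP k j0.
suff : `|u (last k p)| = `|u k|.
  by rewrite -ej0 uj0 normr0 => /esym/eqP; rewrite (negPf uk0).
have : `|u k| = `|u k| by [].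
move: {1 2 4}k pth => j; elim: p j {ej0} => [//|q p IH] j /= /andP[jq pth] uj.
by apply: IH pth _; exact: step uj jq.
Qed.

(** This entry is the minor without row and column [j0]. A row vector in its left kernel, extended
    by 0 at [j0], satisfies the maximum principle and vanishes. *)
Lemma adjugate_diag_neq0 (c : R) (j0 : 'I_d) :
  c != 0 -> \adj (c *: (1%:M - P)) j0 j0 != 0.
Proof.
move=> c0; rewrite mxE /cofactor mulf_eq0 signr_eq0 /=.
apply/negP => /det0P[u u0 uB]; case/negP: u0; apply/eqP/matrixP => z k; rewrite ord1 mxE.
pose U i := if unlift j0 i is Some k then u 0 k else 0.
have -> : u 0 k = U (lift j0 k) by rewrite /U liftK.
apply: (max_principle (j0 := j0)); first by rewrite /U unlift_none.
move=> j; case: (unliftP j0 j) => [q ->|->]; last by rewrite eqxx.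
move=> _; have /matrixP/(_ 0 q) := uB.
rewrite !mxE (_ : \sum_i _ = c * (U (lift j0 q) - \sum_i U i * P i (lift j0 q))).
  by move/eqP; rewrite mulf_eq0 (negPf c0) subr_eq0 => /eqP.
rewrite [in RHS](bigD1_ord j0) //= {2}/U unlift_none mul0r add0r.
have -> : U (lift j0 q) = \sum_i u 0 i * (i == q)%:R.
  rewrite /U liftK (bigD1 q) //= eqxx mulr1 big1 ?addr0 // => i /negPf ->.
  by rewrite mulr0.
rewrite -sumrB mulr_sumr; apply: eq_bigr => i _; rewrite !mxE /U liftK.
by rewrite (inj_eq lift_inj); ring.
Qed.

(** The row of ones is in the left kernel of [I - P], so the determinant is 0 and the columns of the
    adjugate lie in the right kernel. *)
Lemma adjugate_stationary (c : R) (j0 : 'I_d) :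
  c != 0 -> forall i,
  \sum_j P i j * \adj (c *: (1%:M - P)) j j0 = \adj (c *: (1%:M - P)) i j0.
Proof.
move=> c0 i; set B := c *: _.
have detB : \det B = 0.
  apply/eqP/det0P; exists (const_mx 1).
    apply/eqP => /matrixP/(_ 0 j0)/eqP; rewrite !mxE.
    by rewrite oner_eq0.
  rewrite /B -scalemxAr mulmxBr mulmx1; apply/matrixP => z j; rewrite !mxE.
  under eq_bigr do rewrite mxE mul1r.
  by rewrite stochP.2 subrr mulr0.
have BB : B *m \adj B = 0 by rewrite mul_mx_adj detB raddf0.
have PB : P *m \adj B = \adj B.
  apply/esym/eqP; rewrite -subr_eq0 -{1}[\adj B]mul1mx -mulmxBl.
  by rewrite -(inj_eq (scalerI c0)) scaler0 scalemxAl BB.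
by rewrite -{2}PB mxE.
Qed.

End StationaryVector.

(** * Convergence of the averages *)

Section MeanConvergence.
Local Open Scope classical_set_scope.
Local Open Scope ring_scope.

Lemma sum_periodic (V : zmodType) (L : nat) (b : nat -> V) :
  (0 < L)%N -> (forall n, b (n + L)%N = b n) ->
  forall n, \sum_(k < L) b (n + k)%N = \sum_(k < L) b k.
Proof.
move=> L0 bL; elim=> [//|n <-].
have bn : b (n.+1 + L.-1)%N = b (n + 0)%N.
  by rewrite addn0 -[RHS]bL; congr b; lia.
rewrite -[in LHS](prednK L0) -[in RHS](prednK L0) big_ord_recr big_ord_recl /= bn.
by rewrite addrC; congr (_ + _); apply: eq_bigr => k _; rewrite addSnnS.
Qed.

(** The partial sums of [b k - s], with [s] the mean over one period, are themselves periodic, hence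
    bounded; divided by [n] they tend to 0. *)
Lemma cvg_mean_periodic (R : realType) (L : nat) (b : nat -> R) :
  (0 < L)%N -> (forall n, b (n + L)%N = b n) ->
  (fun n => n%:R^-1 * \sum_(k < n) b k) @ \oo --> L%:R^-1 * \sum_(k < L) b k.
Proof.
move=> L0 bL; set s := L%:R^-1 * _.
have L1 : L%:R != 0 :> R by rewrite pnatr_eq0 -lt0n.
pose S n : R := \sum_(k < n) (b k - s).
have SL n : S (n + L)%N = S n.
  have -> : S (n + L)%N = S n + \sum_(k < L) (b (n + k)%N - s).
    by rewrite /S big_split_ord.
  rewrite sumrB sumr_const card_ord -[s *+ L]mulr_natl mulVKf //.
  by rewrite sum_periodic // subrr addr0.
have Smod n : S n = S (n %% L)%N.
  rewrite {1}(divn_eq n L) addnC; elim: (n %/ L)%N => [|q IH]; first by rewrite addn0.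
  by rewrite mulSn [(L + _)%N]addnC addnA SL IH.
pose C := \sum_(k < L) `|S k|.
have SC n : `|S n| <= C.
  rewrite Smod /C (bigD1 (Ordinal (ltn_pmod n L0))) //= lerDl sumr_ge0 //.
apply/cvgrPdist_lt => e e0; near=> n.
have n0 : 0 < n%:R :> R by rewrite ltr0n; near: n; exact: nbhs_infty_gt.
have -> : s - n%:R^-1 * \sum_(k < n) b k = - (n%:R^-1 * S n).
  rewrite /S sumrB sumr_const card_ord mulrBr -[s *+ n]mulr_natl mulKf ?opprB //.
  by rewrite gt_eqF.
rewrite normrN normrM gtr0_norm ?invr_gt0 // ltr_pdivrMl //.
apply: le_lt_trans (SC n) _; rewrite -ltr_pdivrMr //.
by near: n; exact: nbhs_infty_gtr.
Unshelve. all: by end_near. Qed.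

Lemma cvg_mean_asymptotic (R : realType) (a b : nat -> R) (l : R) :
  (fun n => a n - b n) @ \oo --> (0 : R) ->
  (fun n => n%:R^-1 * \sum_(k < n) b k) @ \oo --> l ->
  (fun n => n%:R^-1 * \sum_(k < n) a k) @ \oo --> l.
Proof.
move=> /cesaro; rewrite /arithmetic_mean /series /= => ab bl.
have ab0 : (fun n => n%:R^-1 * \sum_(k < n) (a k - b k)) @ \oo --> (0 : R).
  (* [arithmetic_mean] at index [n] averages [n.+1] terms, hence the shift. *)
  rewrite -cvg_shiftS /=; apply: cvg_trans ab; apply: near_eq_cvg.
  by near=> n; rewrite big_mkord.
rewrite -[l]add0r (_ : (fun n => _) = (fun n =>
  n%:R^-1 * \sum_(k < n) (a k - b k) + n%:R^-1 * \sum_(k < n) b k)).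
  exact: cvgD ab0 bl.
apply/funext => n; rewrite -mulrDr -big_split /=.
by under [in RHS]eq_bigr do rewrite subrK.
Unshelve. all: by end_near. Qed.

(** [v] takes at most [L] values, so continuity of [w] at finitely many points replaces uniform
    continuity. *)
Lemma cvg_continuous_asymptotic (R : realType) (d L : nat) (w : 'cV[R]_d -> R)
    (u v : nat -> 'cV[R]_d) :
  continuous w -> (0 < L)%N -> (forall m, v (m + L)%N = v m) ->
  (forall e, 0 < e -> \forall m \near \oo, forall i, `|v m i 0 - u m i 0| < e) ->
  (fun m => w (u m) - w (v m)) @ \oo --> (0 : R).
Proof.
move=> wc L0 vL uv; apply/cvgrPdist_lt => e e0.
have vmod m : v m = v (m %% L)%N.
  rewrite {1}(divn_eq m L) addnC; elim: (m %/ L)%N => [|q IH]; first by rewrite addn0.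
  by rewrite mulSn [(L + _)%N]addnC addnA vL IH.
have near_v (k : 'I_L) : \forall m \near \oo,
    v m = v k -> `|w (u m) - w (v m)| < e.
  have /cvgrPdist_lt/(_ e e0)/nbhs_ballP[r /= r0 hr] := wc (v k).
  have := uv r r0; apply: filterS => m um vm; rewrite distrC vm; apply: hr; split=> // i j.
  by rewrite ord1 /ball /= -vm.
have : \forall m \near \oo, forall k : 'I_L,
    v m = v k -> `|w (u m) - w (v m)| < e by exact: filter_forall.
apply: filterS => m hm.
rewrite sub0r normrN; apply: (hm (Ordinal (ltn_pmod m L0))).
exact: vmod.
Qed.

Lemma mean_payoff_cyclic (R : realType) (d N L : nat) (P : 'M[R]_d)
    (alpha : 'I_d -> R) (iota : 'cV[R]_d) (w : 'cV[R]_d -> R) (N1 : nat) :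
  stochastic P -> irreducible_chain P -> distribution_vector iota ->
  (0 < L)%N -> pattern P (N + L) = pattern P N ->
  (forall k, (0 < k < L)%N -> pattern P (N + k) <> pattern P N) ->
  (forall i, 0 < alpha i) -> \sum_i alpha i = 1 ->
  (forall i, \sum_j P i j * alpha j = alpha i) ->
  continuous w -> (N <= N1)%N ->
  average_payoff w P iota @ \oo -->
    L%:R^-1 * \sum_(k < L) w (cyclic_limit P L alpha (N1 + k)%N *m iota).
Proof.
move=> stochP irrP [iota0 iota1] L0 pL Lmin a0 a1 Pa wc NN1.
pose E m := cyclic_limit P L alpha m.
have EL m c : (N <= m)%N -> E (m + c * L)%N = E m.
  by move=> Nm; exact: (cyclic_limit_periodic stochP L0 pL).
have NLN : (N <= N * L)%N by rewrite leq_pmulr.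
(* [E] is periodic only from [N] on. The shift by a multiple of [L] makes [v] periodic from 0 on and
   keeps the values at [m >= N]. *)
pose v m := E (N * L + m)%N *m iota.
have vL m : v (m + L)%N = v m.
  by rewrite /v addnA -{2}[L]mul1n EL // (leq_trans NLN) ?leq_addr.
have vE m : (N <= m)%N -> v m = E m *m iota by move=> Nm; rewrite /v addnC EL.
have -> : \sum_(k < L) w (E (N1 + k)%N *m iota) = \sum_(k < L) w (v k).
  have -> : \sum_(k < L) w (E (N1 + k)%N *m iota) = \sum_(k < L) w (v (N1 + k)%N).
    by apply: eq_bigr => k _; rewrite vE // (leq_trans NN1) ?leq_addr.
  by apply: (sum_periodic (b := fun m => w (v m))) => // m; rewrite vL.
apply: (@cvg_mean_asymptotic _ (fun m => w (P ^+ m *m iota)) (fun m => w (v m))); last first.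
  by apply: (@cvg_mean_periodic _ L (fun m => w (v m))) => // m; rewrite vL.
apply: (cvg_continuous_asymptotic wc L0 vL) => e e0.
have [M [c [M0 /andP[c0 c1] PE]]] := exp_cyclic_limit_geometric
  stochP irrP L0 pL Lmin a0 a1 Pa.
have [Q _ hQ] : \forall q \near \oo, d%:R * c ^+ q < e.
  have : (fun q => d%:R * c ^+ q) @ \oo --> d%:R * (0 : R).
    by apply: cvgMr; apply: cvg_expr; rewrite gtr0_norm.
  rewrite mulr0 => /cvgrPdist_lt/(_ e e0); apply: filterS => q.
  by rewrite sub0r normrN; apply: le_lt_trans; exact: ler_norm.
(* One fixed power [Q.+1] serves for all these [m]: what exceeds [Q.+1 * M] goes into the remainder,
   in which the geometric bound is uniform. *)
exists (Q.+1 * M + N)%N => // m /= Qm i.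
have Nm : (N <= m)%N by lia.
have mE : m = (Q.+1 * M + (m - Q.+1 * M))%N by lia.
rewrite vE // distrC; apply: le_lt_trans (hQ Q.+1 (leqnSn Q)).
have -> : (P ^+ m *m iota) i 0 - (E m *m iota) i 0 =
    \sum_j ((P ^+ m) i j - E m i j) * iota j 0.
  by rewrite [X in X - _]mxE [X in _ - X]mxE -sumrB; under eq_bigr do rewrite -mulrBl.
apply: le_trans (ler_norm_sum _ _ _) _.
have -> : d%:R * c ^+ Q.+1 = \sum_j d%:R * c ^+ Q.+1 * iota j 0.
  by rewrite -mulr_sumr iota1 mulr1.
apply: ler_sum => j _.
by rewrite normrM [`|iota _ _|]ger0_norm // ler_wpM2r // mE; exact: PE.
Qed.

End MeanConvergence.

(** * Program logic *)

Definition hoare (V M : nat) (c : code) (s : memory) (Q : memory -> Prop) : Prop :=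
  safe V M c s /\ Q (run c s).

Lemma hoare_asg (V M : nat) (a : nat) (e1 e2 : expr) (s : memory) (Q : memory -> Prop) :
  small V (eval s e2) -> Q (update s a (eval s e1) (eval s e2)) ->
  hoare V M (Asg a e1 e2) s Q.
Proof. by []. Qed.

Lemma hoare_then (V M : nat) (c1 c2 : code) (s : memory) (Q1 Q : memory -> Prop) :
  hoare V M c1 s Q1 ->
  (forall s1, (forall a, a \notin writes c1 -> s1 a =1 s a) -> Q1 s1 ->
     hoare V M c2 s1 Q) ->
  hoare V M (Then c1 c2) s Q.
Proof.
move=> [safe1 Q1s] h; have [|safe2 Qs] := h _ _ Q1s; last by split.
by move=> a; exact: run_frame.
Qed.

Lemma hoare_weaken (V M : nat) (c : code) (s : memory) (Q1 Q : memory -> Prop) :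
  hoare V M c s Q1 ->
  (forall s1, (forall a, a \notin writes c -> s1 a =1 s a) -> Q1 s1 -> Q s1) ->
  hoare V M c s Q.
Proof.
move=> [safe1 Q1s] h; split=> //; apply: h Q1s => a; exact: run_frame.
Qed.

Lemma hoare_loop (V M : nat) (x : nat) (e : expr) (c : code) (s : memory)
    (n : nat) (I : nat -> memory -> Prop) :
  well_formed (Loop x e c) -> eval s e = n%:Z -> (n <= M)%N ->
  (forall k s' s'', (forall a, a != x -> s'' a =1 s' a) -> I k s' -> I k s'') ->
  I 0%N s ->
  (forall k s', (k < n)%N -> s' x 0 = k%:Z ->
     (forall a, a \notin x :: writes c -> s' a =1 s a) -> I k s' ->
     hoare V M c s' (I k.+1)) ->
  hoare V M (Loop x e c) s (I n).
Proof.
move=> wf en nM Ix I0 IS; apply: loop_hoare => //.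
  by apply: Ix I0 => a; exact: update_other.
move=> k s' kn xk fr Ik; have [safec Ic] := IS k s' kn xk fr Ik.
by split=> //; apply: Ix Ic => a; exact: update_other.
Qed.

Lemma hoare_fill (V M : nat) (x : nat) (e : expr) (c : code) (s : memory) (a n : nat)
    (f : nat -> int) :
  well_formed (Loop x e c) -> a != x -> eval s e = n%:Z -> (n <= M)%N ->
  (forall k s', (k < n)%N -> s' x 0 = k%:Z ->
     (forall b, b \notin x :: writes c -> s' b =1 s b) ->
     hoare V M c s' (fun s'' => forall j, s'' a j = if j == k%:Z then f k else s' a j)) ->
  hoare V M (Loop x e c) s (fun s' => forall k, (k < n)%N -> s' a k%:Z = f k).
Proof.
move=> wf ax en nM body.
apply: (hoare_loop (I := fun m s' =>
  forall k, (k < m)%N -> s' a k%:Z = f k)) wf en nM _ _ _ => //.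
  by move=> m s' s'' h I0 k km; rewrite h // I0.
move=> k s' kn xk fr Ik; apply: hoare_weaken (body k s' kn xk fr) _ => s1 _ s1a j.
rewrite ltnS leq_eqVlt s1a => /orP[/eqP->|jk]; first by rewrite eqxx.
by rewrite ifF ?Ik //; apply/eqP; case=> jk'; rewrite jk' ltnn in jk.
Qed.

Lemma hoare_map (V M : nat) (x : nat) (e r : expr) (s : memory) (a n : nat)
    (f : nat -> int) :
  well_formed (Loop x e (Asg a (Get x (Const 0)) r)) -> a != x ->
  eval s e = n%:Z -> (n <= M)%N ->
  (forall k s', (k < n)%N -> s' x 0 = k%:Z ->
     (forall b, b \notin [:: x; a] -> s' b =1 s b) -> eval s' r = f k) ->
  (forall k, (k < n)%N -> small V (f k)) ->
  hoare V M (Loop x e (Asg a (Get x (Const 0)) r)) s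
    (fun s' => forall k, (k < n)%N -> s' a k%:Z = f k).
Proof.
move=> wf ax en nM rf fV; apply: hoare_fill => // k s' kn xk fr.
apply: hoare_asg; rewrite (rf k s') ?fV //= => j.
by rewrite /update eqxx /= xk.
Qed.

Definition fold_code (x : nat) (e : expr) (acc : nat) (init r : expr) : code :=
  Then (Asg acc (Const 0) init) (Loop x e (Asg acc (Const 0) r)).

Lemma hoare_fold (V M : nat) (x : nat) (e : expr) (acc : nat) (init r : expr)
    (s : memory) (n : nat) (F : nat -> int) :
  acc != x -> acc \notin reads e -> x \notin reads e ->
  eval s e = n%:Z -> (n <= M)%N -> eval s init = F 0%N ->
  (forall k s', (k < n)%N -> s' x 0 = k%:Z -> s' acc 0 = F k ->
     (forall b, b \notin [:: x; acc] -> s' b =1 s b) -> eval s' r = F k.+1) ->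
  (forall k, (k <= n)%N -> small V (F k)) ->
  hoare V M (fold_code x e acc init r) s (fun s' => s' acc 0 = F n).
Proof.
move=> ax ae xe en nM i0 rF FV.
have wf : well_formed (Loop x e (Asg acc (Const 0) r)).
  rewrite /= inE eq_sym ax andbT; apply/hasPn => b be; rewrite /= !inE negb_or.
  by apply/andP; split; apply: contraTneq be => ->.
apply: (@hoare_then _ _ _ _ _ (fun s1 => s1 acc 0 = F 0%N)).
  by apply: hoare_asg; rewrite i0 ?FV // /update /= !eqxx.
move=> s1 fr1 s1acc.
have en1 : eval s1 e = n%:Z.
  rewrite -en; apply: eval_frame => b be; apply: fr1; rewrite inE.
  by apply: contraNneq ae => <-.
apply: (hoare_loop (I := fun k s' => s' acc 0 = F k)) wf en1 nM _ _ _ => //.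
  by move=> k s' s'' h <-; rewrite h.
move=> k s' kn xk fr Ik; have rk : eval s' r = F k.+1.
  apply: rF => // b; rewrite !inE negb_or => /andP[bx bacc] j.
  by rewrite fr ?fr1 ?inE ?negb_or ?bx.
by apply: hoare_asg; rewrite rk ?FV // /update /= !eqxx.
Qed.

Lemma smallE (V : nat) (z : int) : small V z = (`|z| < (2 ^ V)%N%:Z).
Proof. by rewrite -abszE ltz_nat. Qed.

Lemma hoare_sum (V M : nat) (x : nat) (e : expr) (acc : nat) (r : expr)
    (s : memory) (n b : nat) (f : 'I_n -> int) :
  acc != x -> acc \notin reads e -> x \notin reads e ->
  eval s e = n%:Z -> (n <= M)%N ->
  (forall (i : 'I_n) s', s' x 0 = i%:Z ->
     (forall c, c \notin [:: x; acc] -> s' c =1 s c) -> eval s' r = f i) ->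
  (forall i, `|f i| <= b%:Z) -> (n * b < 2 ^ V)%N ->
  hoare V M (fold_code x e acc (Const 0) (Plus (Get acc (Const 0)) r)) s
    (fun s' => s' acc 0 = \sum_i f i).
Proof.
move=> ax ae xe en nM rf fb nb; pose F k := \sum_(l < n | (l < k)%N) f l.
have -> : \sum_i f i = F n by apply: eq_bigl => l; rewrite ltn_ord.
apply: hoare_fold => //=.
- by rewrite /F big1.
- move=> k s' kn xk acck fr; rewrite acck (rf (Ordinal kn)) //.
  rewrite /F [in RHS](bigD1 (Ordinal kn)) ?leqnn //= addrC; congr (_ + _).
  by apply: eq_bigl => l; rewrite ltnS ltn_neqAle andbC.
- move=> k _; rewrite smallE.
  apply: (@le_lt_trans _ _ (n * b)%N%:Z); last by rewrite ltz_nat.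
  apply: le_trans (ler_norm_sum _ _ _) _.
  apply: (@le_trans _ _ (\sum_(l < n | (l < k)%N) b%:Z)).
    by apply: ler_sum => l _; exact: fb.
  rewrite sumr_const -mulr_natl PoszM ler_wpM2r // natz lez_nat.
  by rewrite (leq_trans (max_card _)) ?card_ord.
Qed.

Lemma zero_test (z : int) : 0 <= z -> (1 %/ (1 + z))%Z = (z == 0)%:Z.
Proof.
case: z => // -[//|n] _; rewrite -PoszD add1n divz_nat divn_small //.
Qed.

(** * Matrices stored row by row *)

Section FlatMatrix.
Variable d : nat.

Definition holds_mx (s : memory) (a : nat) (A : 'M[int]_d) : Prop :=
  forall i j : 'I_d, s a (i * d + j)%N%:Z = A i j.

Lemma flat_ltn (i j : 'I_d) : (i * d + j < d * d)%N.
Proof.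
have /= := leq_mul (ltn_ord i) (leqnn d); have := ltn_ord j; rewrite mulSn; lia.
Qed.

Lemma flat_surj (q : nat) : (q < d * d)%N -> exists i j : 'I_d, q = (i * d + j)%N.
Proof.
move=> qd; have d0 : (0 < d)%N by move: qd; case: d => //; rewrite ?muln0 // mul0n.
have q1 : (q %/ d < d)%N by rewrite ltn_divLR.
have q2 : (q %% d < d)%N by rewrite ltn_mod.
by exists (Ordinal q1), (Ordinal q2); rewrite -divn_eq.
Qed.

Lemma flat_div (i j : 'I_d) : ((i * d + j)%N%:Z %/ d%:Z)%Z = i%:Z.
Proof.
rewrite divz_nat divnMDl ?(leq_ltn_trans _ (ltn_ord j)) //.
by rewrite divn_small ?addn0.
Qed.

Lemma flat_mod (i j : 'I_d) :
  (i * d + j)%N%:Z - ((i * d + j)%N%:Z %/ d%:Z)%Z * d%:Z = j%:Z.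
Proof. by rewrite flat_div PoszD PoszM addrAC subrr add0r. Qed.

Definition flat_fun (A : 'M[int]_d) (q : nat) : int :=
  if insub (q %/ d)%N is Some i then
    if insub (q %% d)%N is Some j then A i j else 0
  else 0.

Lemma flat_funE (A : 'M[int]_d) (i j : 'I_d) : flat_fun A (i * d + j) = A i j.
Proof.
have d0 : (0 < d)%N := leq_ltn_trans (leq0n _) (ltn_ord j).
rewrite /flat_fun divnMDl // modnMDl divn_small ?modn_small // addn0.
by rewrite !insubT //= => *; congr (A _ _); apply: val_inj.
Qed.

Lemma hoare_map_mx (V M x : nat) (e r : expr) (s : memory) (a : nat) (A : 'M[int]_d) :
  well_formed (Loop x e (Asg a (Get x (Const 0)) r)) -> a != x ->
  eval s e = (d * d)%N%:Z -> (d * d <= M)%N ->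
  (forall (i j : 'I_d) s', s' x 0 = (i * d + j)%N%:Z ->
     (forall b, b \notin [:: x; a] -> s' b =1 s b) -> eval s' r = A i j) ->
  (forall i j, small V (A i j)) ->
  hoare V M (Loop x e (Asg a (Get x (Const 0)) r)) s
    (fun s' => holds_mx s' a A).
Proof.
move=> wf ax en dM rA AV; apply: hoare_weaken; first
  apply: (hoare_map (n := (d * d)%N) (f := flat_fun A)) => //.
- by move=> q s' /flat_surj[i [j ->]] xq fr; rewrite flat_funE; exact: rA.
- by move=> q /flat_surj[i [j ->]]; rewrite flat_funE.
- by move=> s1 _ s1a i j; rewrite s1a ?flat_funE // flat_ltn.
Qed.

End FlatMatrix.

(** Arrays [a_x], [a_y], [a_z] hold loop counters, [a_acc] the accumulator, [a_D] the common
    denominator, [a_X] the entries of [P] and then of [iota] times it. Patterns: [a_B] of [P], [a_C]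
    the current one, [a_T] a fresh product, [a_F] the one at [N]. Then [a_L] is the period, [a_Y] is
    [D P - D I], [a_N] the Faddeev-LeVerrier matrix, [a_S] the sum of its first column. *)
Local Notation a_in := 0%N.
Local Notation a_out := 1%N.
Local Notation a_x := 2%N.
Local Notation a_y := 3%N.
Local Notation a_z := 4%N.
Local Notation a_acc := 5%N.
Local Notation a_D := 6%N.
Local Notation a_X := 7%N.
Local Notation a_B := 8%N.
Local Notation a_C := 9%N.
Local Notation a_T := 10%N.
Local Notation a_F := 11%N.
Local Notation a_L := 12%N.
Local Notation a_Y := 13%N.
Local Notation a_N := 14%N.
Local Notation a_S := 15%N.

Local Notation var a := (Get a (Const 0)).
Local Notation dim := (var a_in).
Local Notation dim2 := (Times dim dim).
Local Notation row_x := (Quot (var a_x) dim).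
Local Notation col_x := (Minus (var a_x) (Times row_x dim)).

(* For e >= 0 the rounded quotient is 1 if e = 0 and 0 otherwise. *)
Definition is_zero (e : expr) : expr := Quot (Const 1) (Plus (Const 1) e).
Definition is_positive (e : expr) : expr := Minus (Const 1) (is_zero e).

(** The expression [g] is applied to each finished entry, read in [a_acc]: [is_positive] turns the
    integer product into the Boolean one. *)
Definition mat_mul (c a b : nat) (g : expr) : code :=
  Loop a_x dim2
    (Then
      (fold_code a_z dim a_acc (Const 0)
        (Plus (var a_acc)
          (Times (Get a (Plus (Times row_x dim) (var a_z)))
            (Get b (Plus (Times (var a_z) dim) col_x)))))
      (Asg c (var a_x) g)).

Lemma hoare_mat_mul (V M c a b : nat) (g : expr) (h : int -> int) (s : memory)
    (d m : nat) (A B : 'M[int]_d) :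
  all (fun v => v \notin [:: a_in; a_x; a_z; a_acc]) [:: a; b; c] ->
  c != a -> c != b ->
  (forall s', eval s' g = h (s' a_acc 0)) ->
  s a_in 0 = d%:Z -> (d * d <= M)%N -> (d <= M)%N ->
  holds_mx s a A -> holds_mx s b B ->
  (forall i j k, `|A i k * B k j| <= m%:Z) -> (d * m < 2 ^ V)%N ->
  (forall i j, small V (h ((A *m B) i j))) ->
  hoare V M (mat_mul c a b g) s (fun s' => holds_mx s' c (map_mx h (A *m B))).
Proof.
move=> /and4P[na nb nc _] ca cb gh sd dM dM' sA sB ABm mV hV.
rewrite !inE !negb_or in na nb nc.
case/and4P: na => a0 a1 a2 a3; case/and4P: nb => b0 b1 b2 b3; case/and4P: nc => c0 c1 c2 c3.
apply: hoare_weaken; first apply: (hoare_fill (a := c) (n := (d * d)%N)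
    (f := flat_fun (map_mx h (A *m B)))) => //.
- by rewrite /= !inE !(eq_sym _ c) (negPf c0) (negPf c1).
- by rewrite /= sd.
- move=> q s' /flat_surj[i [j ->]] xq fr; rewrite flat_funE mxE.
  have s'd : s' a_in 0 = d%:Z by rewrite fr // !inE (eq_sym _ c) (negPf c0).
  have s'a : s' a =1 s a.
    by apply: fr; rewrite !inE (negPf a1) (negPf a2) (negPf a3) eq_sym (negPf ca).
  have s'b : s' b =1 s b.
    by apply: fr; rewrite !inE (negPf b1) (negPf b2) (negPf b3) eq_sym (negPf cb).
  apply: (@hoare_then _ _ _ _ _ (fun s1 => s1 a_acc 0 = (A *m B) i j)).
    rewrite mxE; apply: (hoare_sum (b := m)) => //= k s1 zk fr1.
    rewrite zk !(fr1 a_x) // !(fr1 a_in) // xq s'd flat_mod flat_div.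
    rewrite !fr1 ?inE ?negb_or ?a2 ?a3 ?b2 ?b3 // s'a s'b.
    by rewrite -!PoszM -!PoszD sA sB.
  move=> s1 fr1 s1acc; apply: hoare_asg; rewrite gh s1acc // => p.
  rewrite /update eqxx /= (fr1 a_x) // xq; case: ifP => // _.
  by rewrite fr1 // !inE (negPf c2) (negPf c3).
- by move=> s1 _ s1c i j; rewrite s1c ?flat_funE // flat_ltn.
Qed.

(** * The encoded input *)

Section Input.
Variables (d : nat) (P : 'M[rat]_d) (iota : 'cV[rat]_d).

Definition entries : seq rat :=
  [seq P i j | i <- enum 'I_d, j <- enum 'I_d] ++ [seq iota i 0 | i <- enum 'I_d].

Let r q := nth 0 entries q.

Lemma size_entries : size entries = (d * d + d)%N.
Proof. by rewrite size_cat size_allpairs size_map size_enum_ord. Qed.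

Lemma nth_allpairs (S T U : Type) (f : S -> T -> U) (s : seq S) (t : seq T)
    (x : S) (y : T) (z : U) (i j : nat) :
  (i < size s)%N -> (j < size t)%N ->
  nth z [seq f x y | x <- s, y <- t] (i * size t + j) = f (nth x s i) (nth y t j).
Proof.
elim: s i => [//|a s IH] [|i] /= si tj; rewrite nth_cat size_map.
  by rewrite mul0n add0n tj (nth_map y).
by rewrite mulSn -addnA ltnNge leq_addr /= addKn IH.
Qed.

Lemma nth_entries_mx (i j : 'I_d) : r (i * d + j)%N = P i j.
Proof.
rewrite /r /entries nth_cat size_allpairs size_enum_ord flat_ltn.
have := nth_allpairs (s := enum 'I_d) (t := enum 'I_d) (fun i j => P i j) i j 0
  (i := i) (j := j).
by rewrite size_enum_ord !nth_ord_enum => ->.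
Qed.

Lemma nth_entries_vec (j : 'I_d) : r (d * d + j)%N = iota j 0.
Proof.
rewrite /r /entries nth_cat size_allpairs size_enum_ord ltnNge leq_addr /=.
by rewrite addKn (nth_map j) ?size_enum_ord // nth_ord_enum.
Qed.

Lemma nth_numden (s : seq rat) (q : nat) : (q < size s)%N ->
  nth 0 (flatten [seq [:: numq x; denq x] | x <- s]) (2 * q)%N = numq (nth 0 s q) /\
  nth 0 (flatten [seq [:: numq x; denq x] | x <- s]) (2 * q).+1 = denq (nth 0 s q).
Proof.
elim: s q => [//|x s IH] [//|q] qs; rewrite mulnS add2n; exact: IH.
Qed.

Lemma input_num (q : nat) : (q < d * d + d)%N ->
  initial_memory (encode_input P iota) 0%N (2 * q).+1%:Z = numq (r q).
Proof.
rewrite -size_entries => qs; have [h _] := nth_numden qs.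
by rewrite /= -/entries h.
Qed.

Lemma input_den (q : nat) : (q < d * d + d)%N ->
  initial_memory (encode_input P iota) 0%N (2 * q).+2%:Z = denq (r q).
Proof.
rewrite -size_entries => qs; have [_ h] := nth_numden qs.
by rewrite /= -/entries h.
Qed.

Lemma input_bitsE : input_bits P iota = (\sum_(q < d * d + d) rat_bits (r q))%N.
Proof.
rewrite -size_entries -(big_mkord xpredT (fun q => rat_bits (r q))) -(big_nth 0 xpredT).
rewrite /entries big_cat /= big_allpairs_dep big_map /= !big_enum /=.
by congr addn; apply: eq_bigr => i _; rewrite big_enum.
Qed.

Lemma rat_bits_ge2 (x : rat) : (2 <= rat_bits x)%N.
Proof. by rewrite /rat_bits /bit_length addSn addnS. Qed.

Lemma input_bits_dim : (2 * (d * d + d) <= input_bits P iota)%N.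
Proof.
rewrite input_bitsE -[X in (_ * X)%N]card_ord mulnC -sum_nat_const.
by apply: leq_sum => q _; exact: rat_bits_ge2.
Qed.

Lemma input_small (q : nat) : (q < d * d + d)%N ->
  small (input_bits P iota) (numq (r q)) /\ small (input_bits P iota) (denq (r q)).
Proof.
move=> qs; have le : (rat_bits (r q) <= input_bits P iota)%N.
  by rewrite input_bitsE (bigD1 (Ordinal qs)) //= leq_addr.
split; apply: smallW (small_bit_length _); apply: leq_trans le.
  exact: leq_addr.
exact: leq_addl.
Qed.

Lemma small_initial_memory :
  small_memory (input_bits P iota) (initial_memory (encode_input P iota)).
Proof.
set n := input_bits P iota.
have small0 : small n 0 by rewrite /small expn_gt0.
suff /allP h : all (small n) (encode_input P iota).
  move=> [|a] [k|k] //=; have [ks|ks] := ltnP k (size (encode_input P iota)).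
    exact/h/mem_nth.
  by rewrite nth_default.
apply/andP; split.
  have := input_bits_dim; rewrite -/n /small => dn.
  by apply: leq_ltn_trans (ltn_expl n _) => //; lia.
apply/allP => z /flattenP[w /mapP[x /(nthP 0)[q]]].
rewrite size_entries => /input_small[hn hd] <- ->.
by rewrite !inE => /orP[] /eqP ->.
Qed.

(** The common denominator is the plain product of all denominators: its length is at most the sum
    of theirs, hence at most the input length. Partial products occur because the program stores
    them. *)
Lemma partial_den_bound (k : nat) : (k <= d * d + d)%N ->
  0 < \prod_(q < d * d + d | (q < k)%N) denq (r q) <= (2 ^ input_bits P iota)%N%:Z.
Proof.
move=> kn; rewrite prodr_gt0 /=; last by move=> q _; exact: denq_gt0.
rewrite input_bitsE expn_sum -natz natr_prod big_mkcond /=.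
apply: ler_prod => q _; case: ifP => _; rewrite ?ler01 ?(ltW (denq_gt0 _)) /=.
  have := small_bit_length (denq (r q)); rewrite smallE gtr0_norm ?denq_gt0 // => h.
  by rewrite natz (le_trans (ltW h)) // lez_nat leq_exp2l // leq_addl.
by rewrite natz lez_nat expn_gt0.
Qed.

End Input.

(** * The program *)

Definition copy (a b : nat) : code := Loop a_x dim2 (Asg a (var a_x) (Get b (var a_x))).

(** The product goes through [a_T] because [mat_mul] must not overwrite its operands. *)
Definition bool_step (a b : nat) : code :=
  Then (mat_mul a_T a b (is_positive (var a_acc))) (copy a_C a_T).

Definition load : code :=
  Then
    (fold_code a_x (Plus dim2 dim) a_D (Const 1)
      (Times (var a_D) (Get a_in (Plus (Times (Const 2) (var a_x)) (Const 2)))))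
    (Loop a_x (Plus dim2 dim)
      (Asg a_X (var a_x)
        (Times (Get a_in (Plus (Times (Const 2) (var a_x)) (Const 1)))
          (Quot (var a_D) (Get a_in (Plus (Times (Const 2) (var a_x)) (Const 2))))))).

Definition powers : code :=
  Then (Loop a_x dim2 (Asg a_B (var a_x) (is_positive (Get a_X (var a_x)))))
    (Then (copy a_C a_B) (Loop a_y dim2 (bool_step a_C a_C))).

Lemma positive_test (z : int) : 0 <= z -> 1 - (1 %/ (1 + z))%Z = (0 < z)%R%:Z.
Proof.
by move=> z0; rewrite zero_test // lt0r z0 andbT; case: eqVneq.
Qed.

Lemma small01 (V : nat) (z : int) : (0 < V)%N -> 0 <= z <= 1 -> small V z.
Proof.
move=> V0 z01; rewrite smallE (@le_lt_trans _ _ 1%N%:Z) //; first lia.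
by rewrite ltz_nat -{1}(expn0 2) ltn_exp2l.
Qed.

Section BooleanPowers.
Variables (d : nat) (P : 'M[rat]_d) (V M : nat).
Hypotheses (stochP : stochastic P) (dM : (d * d + d <= M)%N) (dV : (d < 2 ^ V)%N).

Definition pattern_mx (m : nat) : 'M[int]_d := \matrix_(i, j) (walk P m i j)%:Z.

Lemma pattern_mx01 (m : nat) (i j : 'I_d) : 0 <= pattern_mx m i j <= 1.
Proof. by rewrite mxE; case: walk. Qed.

Lemma pattern_mx_inj (a b : nat) : pattern_mx a = pattern_mx b <-> pattern P a = pattern P b.
Proof.
split=> /matrixP h; apply/matrixP => i j; have := h i j; rewrite !mxE; last by move=> ->.
by case: walk; case: walk.
Qed.

Lemma pattern_mxD (p q : nat) :
  map_mx (fun z : int => 1 - (1 %/ (1 + z))%Z) (pattern_mx p *m pattern_mx q) =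
  pattern_mx (p + q).
Proof.
apply/matrixP => i j; rewrite !mxE.
have t0 k : 0 <= pattern_mx p i k * pattern_mx q k j by rewrite !mxE.
rewrite positive_test ?sumr_ge0 //; congr (nat_of_bool _)%:Z.
apply/idP/idP => [s0|/(walkDP stochP)[k wp wq]]; last first.
  by rewrite (bigD1 k) //= ltr_wpDr ?sumr_ge0 // !mxE wp wq.
apply: contraLR s0 => nw; rewrite -leNgt big1 // => k _; rewrite !mxE.
case wp: (walk P p i k); last by rewrite mul0r.
case wq: (walk P q k j); last by rewrite mulr0.
by case/negP: nw; apply/walkDP => //; exists k.
Qed.

Hypothesis V0 : (0 < V)%N.

Lemma pattern_mx_small (m : nat) (i j : 'I_d) : small V (pattern_mx m i j).
Proof. exact: small01 V0 (pattern_mx01 m i j). Qed.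

Lemma hoare_copy (a b : nat) (A : 'M[int]_d) (s : memory) :
  a != b -> a \notin [:: a_in; a_x] -> b != a_x -> s a_in 0 = d%:Z -> holds_mx s b A ->
  (forall i j, small V (A i j)) ->
  hoare V M (copy a b) s (fun s' => holds_mx s' a A).
Proof.
move=> ab; rewrite !inE negb_or => /andP[a0 a2] bx sd sb AV; apply: hoare_map_mx => //=.
- by rewrite !inE !(eq_sym _ a) (negPf a0) (negPf a2).
- by rewrite sd.
- lia.
move=> i j s' xk fr; rewrite xk fr ?sb // !inE negb_or bx /=.
by rewrite eq_sym.
Qed.

Lemma hoare_bool_step (a b p q : nat) (s : memory) :
  all (fun v => v \notin [:: a_in; a_x; a_z; a_acc]) [:: a; b; a_T] ->
  a_T != a -> a_T != b -> s a_in 0 = d%:Z ->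
  holds_mx s a (pattern_mx p) -> holds_mx s b (pattern_mx q) ->
  hoare V M (bool_step a b) s (fun s' => holds_mx s' a_C (pattern_mx (p + q))).
Proof.
move=> fresh Ta Tb sd sa sb.
apply: hoare_then; first apply: (hoare_mat_mul (m := 1) (h := fun z => 1 - (1 %/ (1 + z))%Z)
  fresh Ta Tb _ sd _ _ sa sb).
- by [].
- lia.
- lia.
- move=> i j k; rewrite !mxE; by case: walk; case: walk.
- by rewrite muln1.
- move=> i j; have /matrixP/(_ i j) := pattern_mxD p q; rewrite mxE => ->.
  exact: pattern_mx_small.
move=> s1 fr1; rewrite pattern_mxD => s1T.
apply: hoare_copy => //; first by rewrite fr1.
exact: pattern_mx_small.
Qed.

Lemma hoare_powers (s : memory) (X : 'M[int]_d) :
  s a_in 0 = d%:Z -> holds_mx s a_X X -> (forall i j, 0 <= X i j) ->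
  (forall i j, (0 < X i j) = walk P 1 i j) ->
  hoare V M powers s (fun s' =>
    holds_mx s' a_B (pattern_mx 1) /\ holds_mx s' a_C (pattern_mx (2 ^ (d * d)))).
Proof.
move=> sd sX X0 XP; apply: hoare_then.
  apply: (hoare_map_mx (A := pattern_mx 1)) => //=.
  - by rewrite sd.
  - lia.
  - move=> i j s' xk fr; rewrite xk fr // sX positive_test // mxE XP //.
  - exact: pattern_mx_small.
move=> s1 fr1 s1B; apply: hoare_then.
  apply: (hoare_copy (b := a_B) (A := pattern_mx 1)) => //; first by rewrite fr1.
  exact: pattern_mx_small.
move=> s2 fr2 s2C; apply: hoare_weaken.
  apply: (hoare_loop (n := (d * d)%N)
    (I := fun k s' => holds_mx s' a_C (pattern_mx (2 ^ k)))) => //=.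
  - by rewrite fr2 // fr1 // sd.
  - lia.
  - by move=> k s' s'' h s'C i j; rewrite h.
  move=> k s' kd yk fr s'C; rewrite expnS mul2n -addnn.
  by apply: hoare_bool_step => //; rewrite fr // fr2 // fr1.
move=> s3 fr3 s3C; split=> // i j; by rewrite fr3 // fr2.
Qed.

End BooleanPowers.

Lemma hoare_load (V M d : nat) (num den : nat -> int) (s : memory) :
  s a_in 0 = d%:Z -> (d * d + d <= M)%N ->
  (forall q, (q < d * d + d)%N -> s a_in (2 * q).+1%:Z = num q) ->
  (forall q, (q < d * d + d)%N -> s a_in (2 * q).+2%:Z = den q) ->
  let D := \prod_(q < d * d + d) den q in
  (forall k, (k <= d * d + d)%N -> small V (\prod_(q < d * d + d | (q < k)%N) den q)) ->
  (forall q, (q < d * d + d)%N -> small V (num q * (D %/ den q)%Z)) ->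
  hoare V M load s (fun s' => s' a_D 0 = D /\
    forall q, (q < d * d + d)%N -> s' a_X q%:Z = num q * (D %/ den q)%Z).
Proof.
move=> sd dM snum sden D DV XV.
pose F k := \prod_(q < d * d + d | (q < k)%N) den q.
have FD : F (d * d + d)%N = D by apply: eq_bigl => q; rewrite ltn_ord.
apply: (@hoare_then _ _ _ _ _ (fun s1 => s1 a_D 0 = D)).
  rewrite -FD; apply: hoare_fold => //=.
  - by rewrite sd.
  - by rewrite /F big1.
  - move=> k s' kn xk Dk fr; rewrite Dk xk fr // -PoszM -PoszD addn2 sden //.
    rewrite /F [in RHS](bigD1 (Ordinal kn)) ?leqnn //= mulrC; congr (_ * _).
    by apply: eq_bigl => l; rewrite ltnS ltn_neqAle andbC.
move=> s1 fr1 s1D; apply: hoare_weaken.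
  apply: (hoare_map (n := (d * d + d)%N) (f := fun q => num q * (D %/ den q)%Z)) => //=.
    by rewrite fr1 // sd.
  move=> q s' qn xq fr; rewrite xq !fr // !(fr1 a_in) // -PoszM -!PoszD addn1 addn2.
  by rewrite snum // sden // s1D.
by move=> s2 fr2 s2X; split=> //; rewrite fr2.
Qed.

(** The accumulated sum of squares is 0 exactly when the current pattern is that of [N]. The value 0
    of [a_L] means that no period has been found yet; adding [a_L] inside [is_zero] lets only the
    first success count. All [d] turns are made, which leaves the pattern at [N + d] in [a_C]. *)
Definition period : code :=
  Then (copy a_F a_C)
  (Then (Asg a_L (Const 0) (Const 0))
    (Loop a_y dim
      (Then (bool_step a_B a_C)
      (Then
        (fold_code a_x dim2 a_acc (Const 0)
          (Plus (var a_acc)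
            (Times (Minus (Get a_C (var a_x)) (Get a_F (var a_x)))
                   (Minus (Get a_C (var a_x)) (Get a_F (var a_x))))))
        (Asg a_L (Const 0)
          (Plus (var a_L)
            (Times (Plus (var a_y) (Const 1))
              (is_zero (Plus (var a_acc) (var a_L)))))))))).

Lemma hoare_period (d : nat) (P : 'M[rat]_d) (V M N L : nat) (s : memory) :
  stochastic P -> (d * d + d <= M)%N -> (d * d < 2 ^ V)%N -> (d < 2 ^ V)%N -> (0 < V)%N ->
  (0 < L <= d)%N -> pattern P (N + L) = pattern P N ->
  (forall k, (0 < k < L)%N -> pattern P (N + k) <> pattern P N) ->
  s a_in 0 = d%:Z ->
  holds_mx s a_B (pattern_mx P 1) -> holds_mx s a_C (pattern_mx P N) ->
  hoare V M period s (fun s' =>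
    holds_mx s' a_C (pattern_mx P (N + d)) /\ s' a_L 0 = L%:Z).
Proof.
move=> stochP dM ddV dV V0 Ld PL Lmin sd sB sC.
apply: hoare_then.
  apply: (hoare_copy dM dV V0 (A := pattern_mx P N)) => //.
  exact: pattern_mx_small.
move=> s1 fr1 s1F; apply: (@hoare_then _ _ _ _ _ (fun s2 => s2 a_L 0 = 0)).
  by apply: hoare_asg => //=; rewrite /small expn_gt0.
move=> s2 fr2 s2L.
pose I k s' := holds_mx s' a_C (pattern_mx P (N + k)) /\
  s' a_L 0 = (if (L <= k)%N then L else 0%N)%:Z.
apply: hoare_weaken; first apply: (hoare_loop (n := d) (I := I)) => //=.
- by rewrite fr2 // fr1 // sd.
- lia.
- by move=> k s' s'' h [h1 h2]; split=> [i j|]; rewrite h // h1.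
- split=> [i j|]; first by rewrite addn0 fr2 // fr1 // sC.
  by rewrite s2L ifF //; lia.
- move=> k s' kd yk fr [s'C s'L].
  have s'd : s' a_in 0 = d%:Z by rewrite fr // fr2 // fr1 // sd.
  have s'F : holds_mx s' a_F (pattern_mx P N) by move=> i j; rewrite fr // fr2 // s1F.
  have s'B : holds_mx s' a_B (pattern_mx P 1) by move=> i j; rewrite fr // fr2 // fr1 // sB.
  apply: hoare_then.
    by apply: (hoare_bool_step stochP dM dV V0 (p := 1) (q := N + k) (a := a_B) (b := a_C)).
  move=> s3 fr3 s3C.
  pose G i j := (pattern_mx P (N + k.+1) i j - pattern_mx P N i j) *
                (pattern_mx P (N + k.+1) i j - pattern_mx P N i j).
  apply: hoare_then.
    apply: (hoare_sum (n := (d * d)%N) (b := 1)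
      (f := fun q => flat_fun (\matrix_(i, j) G i j) q)) => //=.
    + by rewrite fr3 // s'd.
    + lia.
    + move=> q s4 xq fr4; have [i [j qE]] := flat_surj (ltn_ord q).
      rewrite xq qE flat_funE mxE !fr4 // s3C add1n -addnS.
      by rewrite fr3 // s'F.
    + move=> q; have [i [j ->]] := flat_surj (ltn_ord q); rewrite flat_funE mxE /G !mxE.
      by case: walk; case: walk.
    + by rewrite muln1.
  move=> s4 fr4 s4acc.
  have G0 q : 0 <= flat_fun (\matrix_(i, j) G i j) q.
    rewrite /flat_fun; case: insub => // i; case: insub => // j.
    by rewrite mxE; exact: sqr_ge0.
  have s4d : (s4 a_acc 0 == 0) = (pattern P (N + k.+1) == pattern P N).
    rewrite s4acc psumr_eq0 //; apply/allP/eqP => [h|h q _] /=.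
      apply/pattern_mx_inj/matrixP => i j; apply/eqP; rewrite -subr_eq0.
      have := h (Ordinal (flat_ltn i j)) (mem_index_enum _).
      by rewrite /= flat_funE mxE mulf_eq0 orbb.
    have [i [j ->]] := flat_surj (ltn_ord q); rewrite flat_funE mxE /G.
    by rewrite (proj2 (pattern_mx_inj P _ _) h) subrr mul0r.
  have s4acc0 : 0 <= s4 a_acc 0 by rewrite s4acc sumr_ge0.
  have s4L : s4 a_L 0 = (if (L <= k)%N then L else 0%N)%:Z by rewrite fr4 // fr3.
  have s4y : s4 a_y 0 = k%:Z by rewrite fr4 // fr3.
  have LE : s4 a_L 0 + (s4 a_y 0 + 1) * (1 %/ (1 + (s4 a_acc 0 + s4 a_L 0)))%Z =
      (if (L <= k.+1)%N then L else 0%N)%:Z.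
    rewrite s4y s4L; case: (leqP L k) => Lk.
      rewrite zero_test ?addr_ge0 // leqW // gt_eqF ?mulr0 ?addr0 //.
      by rewrite ltr_wpDl // ltz_nat; case/andP: Ld.
    rewrite add0r addr0 zero_test // s4d; case: (leqP L k.+1) => Lk1.
      by have <- : L = k.+1; [lia|rewrite PL eqxx mulr1; lia].
    by rewrite (negPf (introN eqP (Lmin k.+1 _))) ?mulr0 //; lia.
  apply: hoare_asg; rewrite /= LE.
    by rewrite /small; case: ifP => _; rewrite ?expn_gt0 //; lia.
  split=> [i j|]; last by rewrite /update.
  by rewrite update_other // fr4 // s3C add1n addnS.
by move=> s5 fr5 [s5C s5L]; split=> //; rewrite s5L; case/andP: Ld => _ ->.
Qed.

(* The value is j - i when x = i d + j. *)
Definition diagonal_offset : expr := Minus (var a_x) (Times row_x (Plus dim (Const 1))).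
(** The offset is squared because [is_zero] is correct only for non-negative values. *)
Definition kronecker : expr := is_zero (Times diagonal_offset diagonal_offset).

(** From the identity, which is the top coefficient, [d - 1] steps lead to the adjugate of minus
    [a_Y]. The diagonal of [a_T] sits at the multiples of [d + 1], the first column of [a_N] at
    those of [d]. *)
Definition kernel : code :=
  Then
    (Loop a_x dim2
      (Asg a_Y (var a_x) (Minus (Get a_X (var a_x)) (Times (var a_D) kronecker))))
  (Then (Loop a_x dim2 (Asg a_N (var a_x) kronecker))
  (Then
    (Loop a_y (Minus dim (Const 1))
      (Then (mat_mul a_T a_Y a_N (var a_acc))
      (Then
        (fold_code a_x dim a_acc (Const 0)
          (Plus (var a_acc) (Get a_T (Times (var a_x) (Plus dim (Const 1))))))
        (Loop a_x dim2
          (Asg a_N (var a_x)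
            (Minus (Get a_T (var a_x))
              (Times (Quot (var a_acc) (Plus (var a_y) (Const 1))) kronecker)))))))
    (fold_code a_x dim a_S (Const 0)
      (Plus (var a_S) (Get a_N (Times (var a_x) dim)))))).

Lemma eval_kronecker (d : nat) (i j : 'I_d) (s : memory) :
  s a_in 0 = d%:Z -> s a_x 0 = (i * d + j)%N%:Z -> eval s kronecker = (i == j)%:Z.
Proof.
move=> sd sx; rewrite /= sd sx flat_div.
have -> : (i * d + j)%N%:Z - i%:Z * (d%:Z + 1) = j%:Z - i%:Z.
  by rewrite PoszD PoszM; ring.
by rewrite zero_test ?sqr_ge0 // mulf_eq0 orbb subr_eq0 eqz_nat eq_sym.
Qed.

Lemma hoare_kernel (d D V M : nat) (X : 'M[int]_d) (i0 : 'I_d) (s : memory) :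
  i0 = 0%N :> nat -> (d * d + d <= M)%N -> (0 < D)%N ->
  (forall i j, `|(X - D%:Z%:M) i j| <= D%:Z) ->
  let m := ((2 * d ^ 2 * D) ^ d)%N in
  (d * (d * (D * m)) < 2 ^ V)%N ->
  s a_in 0 = d%:Z -> s a_D 0 = D%:Z -> holds_mx s a_X X ->
  let N := \adj (D%:Z%:M - X) in
  hoare V M kernel s (fun s' =>
    [/\ holds_mx s' a_N N, s' a_S 0 = \sum_i N i i0
      & forall i j, `|N i j| <= m%:Z]).
Proof.
move=> i00 dM D0 YD m mV sd sD sX N.
set Y := X - D%:Z%:M in YD.
have d0 : (0 < d)%N := leq_ltn_trans (leq0n _) (ltn_ord i0).
have NE : adj_coef Y 0 = N by rewrite adj_coef0 opprB.
have m0 : (0 < m)%N by rewrite /m expn_gt0 !muln_gt0 d0 D0.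
have dDmV : (d * (D * m) < 2 ^ V)%N by apply: leq_ltn_trans mV; rewrite leq_pmull.
have DmV : (D * m < 2 ^ V)%N by apply: leq_ltn_trans dDmV; rewrite leq_pmull.
have DV : (D < 2 ^ V)%N by apply: leq_ltn_trans DmV; rewrite leq_pmulr.
have mV1 : (m < 2 ^ V)%N by apply: leq_ltn_trans DmV; rewrite leq_pmull.
have dmV : (d * m < 2 ^ V)%N.
  by apply: leq_ltn_trans dDmV; rewrite leq_mul2l leq_pmull ?orbT.
have small_le (z : int) b : `|z| <= b%:Z -> (b < 2 ^ V)%N -> small V z.
  by move=> zb bV; rewrite smallE (le_lt_trans zb).
have Nm y i j : (y < d)%N -> `|adj_coef Y (d.-1 - y) i j| <= m%:Z.
  move=> yd; apply: le_trans (adj_coef_bound d0 YD yd i j) _.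
  have -> : 2 * d%:Z ^+ 2 * D%:Z = (2 * d ^ 2 * D)%N%:Z by rewrite !PoszM -rmorphXn.
  rewrite -rmorphXn /= lez_nat leq_pexp2l ?muln_gt0 ?d0 //; exact: ltnW.
have YN i j k y : (y < d)%N -> `|Y i k * adj_coef Y (d.-1 - y) k j| <= (D * m)%N%:Z.
  by move=> yd; rewrite normrM PoszM ler_pM // Nm.
have YNd i j y : (y < d)%N -> `|(Y *m adj_coef Y (d.-1 - y)) i j| <= (d * (D * m))%N%:Z.
  move=> yd; rewrite mxE; apply: le_trans (ler_norm_sum _ _ _) _.
  have -> : (d * (D * m))%N%:Z = \sum_(k < d) (D * m)%N%:Z.
    by rewrite sumr_const card_ord -mulr_natl natz -PoszM.
  by apply: ler_sum => k _; exact: YN.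
apply: hoare_then.
  apply: (hoare_map_mx (A := Y)) => //=.
  - by rewrite sd.
  - lia.
  - move=> i j s' xk fr; have s'd : s' a_in 0 = d%:Z by rewrite fr.
    rewrite -[X in _ * X]/(eval s' kronecker) (eval_kronecker s'd xk).
    rewrite xk !fr // sX sD !mxE.
    by case: eqP => _; rewrite ?mulr1n ?mulr0n ?mulr1 ?mulr0.
  - by move=> i j; apply: small_le (YD i j) DV.
move=> s1 fr1 s1Y; apply: hoare_then.
  apply: (hoare_map_mx (A := adj_coef Y (d.-1 - 0))) => //=.
  - by rewrite fr1 // sd.
  - lia.
  - move=> i j s' xk fr; have s'd : s' a_in 0 = d%:Z by rewrite fr // fr1.
    rewrite -[LHS]/(eval s' kronecker) (eval_kronecker s'd xk).
    by rewrite subn0 adj_coef_top // mxE; case: eqP.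
  - by move=> i j; apply: small_le (Nm 0%N i j d0) mV1.
move=> s2 fr2 s2N; apply: hoare_then.
  apply: (hoare_loop (n := d.-1)
    (I := fun k s' => holds_mx s' a_N (adj_coef Y (d.-1 - k)))) => //=.
  - by rewrite fr2 // fr1 // sd; lia.
  - lia.
  - by move=> k s' s'' h s'C i j; rewrite h.
  move=> k s' kd yk fr s'N.
  have s'd : s' a_in 0 = d%:Z by rewrite fr // fr2 // fr1.
  have s'Y : holds_mx s' a_Y Y by move=> i j; rewrite fr // fr2 // s1Y.
  have kd' : (k < d)%N by lia.
  set A := Y *m adj_coef Y (d.-1 - k).
  apply: (@hoare_then _ _ _ _ _ (fun s3 => holds_mx s3 a_T A)).
    rewrite -[A](map_mx_id (f := id)) //.
    apply: (hoare_mat_mul (m := (D * m)%N) (h := id)) => //=; try lia.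
    - by move=> i j l; exact: YN.
    - by move=> i j; exact: small_le (YNd i j k kd') dDmV.
  move=> s3 fr3 s3T; apply: (@hoare_then _ _ _ _ _ (fun s4 => s4 a_acc 0 = \tr A)).
    apply: (hoare_sum (b := (d * (D * m))%N)) => //=.
    - by rewrite fr3 // s'd.
    - lia.
    - move=> i s4 xi fr4; rewrite xi !fr4 // (fr3 a_in) // s'd -s3T; congr (s3 _ _).
      by rewrite PoszD PoszM; ring.
    - by move=> i; exact: YNd.
  move=> s4 fr4 s4acc.
  have kE : (d.-1 - k = (d.-1 - k.+1).+1)%N by lia.
  (* The trace is minus [k.+1] times the next coefficient of the characteristic polynomial: the
     division is exact and the added coefficient becomes a subtracted quotient. *)
  have step : adj_coef Y (d.-1 - k.+1) = A - ((\tr A %/ k.+1%:Z)%Z)%:M.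
    rewrite adj_coef_rec -kE -/A; congr (_ + _); rewrite -raddfN; congr (_%:M).
    have -> : \tr A = - ((char_poly Y)`_(d.-1 - k) *+ k.+1).
      rewrite /A kE tr_mul_adj_coef; last lia.
      by congr (- (_ *+ _)); lia.
    by rewrite -mulr_natr natz -mulNr mulzK // opprK.
  apply: (hoare_map_mx (A := adj_coef Y (d.-1 - k.+1))) => //=.
  - by rewrite fr4 // fr3 // s'd.
  - lia.
  - move=> i j s5 xq fr5; have s5d : s5 a_in 0 = d%:Z by rewrite fr5 // fr4 // fr3.
    rewrite -[X in _ * X]/(eval s5 kronecker) (eval_kronecker s5d xq).
    rewrite xq !fr5 // s4acc (fr4 a_T) // s3T (fr4 a_y) // (fr3 a_y) // yk step.
    rewrite -PoszD addn1 [RHS]mxE [X in _ = _ + X]mxE [X in _ = _ - X]mxE.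
    by case: eqP => _; rewrite ?mulr1n ?mulr0n ?mulr1 ?mulr0.
  - move=> i j; apply: small_le (Nm k.+1 i j _) mV1; lia.
move=> s3 fr3 s3N; rewrite subnn NE in s3N.
have Nb i j : `|N i j| <= m%:Z by rewrite -NE -(subnn d.-1); apply: Nm; lia.
apply: hoare_weaken; first apply: (hoare_sum (b := m) (f := fun i => N i i0)) => //=.
- by rewrite fr3 // fr2 // fr1.
- lia.
- move=> i s4 xi fr4; rewrite xi !fr4 // (fr3 a_in) // fr2 // fr1 // sd -s3N.
  by rewrite i00 addn0 PoszM.
move=> s4 fr4 s4S; split=> // i j.
by rewrite fr4 // s3N.
Qed.

Definition output_cell (k : int) : expr :=
  Plus (Times (Const 2) (Plus (Times (var a_y) dim) (var a_z))) (Const k).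

(** A coordinate of [E_m iota] is [L] times an entry of [alpha], of denominator [S], times a partial
    sum of [iota], of denominator [D]; so all fractions share the denominator [S * D]. The pattern
    advances by one step after each point. *)
Definition output : code :=
  Then (Asg a_out (Const 0) (var a_L))
    (Loop a_y (var a_L)
      (Then
        (Loop a_z dim
          (Then
            (fold_code a_x dim a_acc (Const 0)
              (Plus (var a_acc)
                (Times (Get a_C (Plus (Times (var a_z) dim) (var a_x)))
                       (Get a_X (Plus dim2 (var a_x))))))
          (Then
            (Asg a_out (output_cell 1)
              (Times (Times (var a_L) (Get a_N (Times (var a_z) dim))) (var a_acc)))
            (Asg a_out (output_cell 2) (Times (var a_S) (var a_D))))))
        (bool_step a_B a_C))).

Lemma update_ne (s : memory) (a : nat) (i j v : int) :
  j != i -> update s a i v a j = s a j.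
Proof. by move=> /negPf ji; rewrite /update ji andbF. Qed.

Lemma hoare_output (d : nat) (P : 'M[rat]_d) (V M N1 L b m : nat) (N : 'M[int]_d)
    (i0 : 'I_d) (v : 'I_d -> int) (S D : int) (s : memory) :
  i0 = 0%N :> nat -> stochastic P -> (d * d + d <= M)%N -> (0 < V)%N -> (d < 2 ^ V)%N ->
  (L <= d)%N -> (d * b < 2 ^ V)%N -> (d * m * (d * b) < 2 ^ V)%N ->
  (forall j, `|v j| <= b%:Z) -> (forall j, `|N j i0| <= m%:Z) -> small V (S * D) ->
  s a_in 0 = d%:Z -> holds_mx s a_B (pattern_mx P 1) -> holds_mx s a_C (pattern_mx P N1) ->
  s a_L 0 = L%:Z -> holds_mx s a_N N -> s a_S 0 = S -> s a_D 0 = D ->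
  (forall j : 'I_d, s a_X (d * d + j)%N%:Z = v j) ->
  hoare V M output s (fun s' => s' a_out 0 = L%:Z /\
    forall (i : 'I_L) (j : 'I_d),
      s' a_out (2 * (i * d + j)).+1%:Z =
        L%:Z * N j i0 * (\sum_l pattern_mx P (N1 + i) j l * v l) /\
      s' a_out (2 * (i * d + j)).+2%:Z = S * D).
Proof.
move=> i00 stochP dM V0 dV Ld dbV dmdbV vb Nm SDV sd sB sC sL sN sS sD sX.
pose on (i : nat) (j : 'I_d) := L%:Z * N j i0 * (\sum_l pattern_mx P (N1 + i) j l * v l).
pose written (q : nat) (s' : memory) := s' a_out 0 = L%:Z /\
  forall (i : nat) (j : 'I_d), (i * d + j < q)%N ->
    s' a_out (2 * (i * d + j)).+1%:Z = on i j /\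
    s' a_out (2 * (i * d + j)).+2%:Z = S * D.
apply: (@hoare_then _ _ _ _ _ (written 0%N)).
  apply: hoare_asg; rewrite /= sL; first by apply: (leq_ltn_trans Ld).
  by split.
move=> s1 fr1 s1W; apply: hoare_weaken.
  apply: (hoare_loop (n := L) (I := fun k s' =>
    written (k * d)%N s' /\ holds_mx s' a_C (pattern_mx P (N1 + k)))) => //=.
  - by rewrite fr1 // sL.
  - lia.
  - move=> k s' s'' h [[h1 h2] h3]; split=> [|i j]; last by rewrite h.
    by split=> [|i j ij]; rewrite ?h //; have [] := h2 i j ij.
  - by split=> // i j; rewrite addn0 fr1 // sC.
  move=> k s' kL yk fr [s'W s'C].
  have s's a : a \notin [:: a_out; a_x; a_y; a_z; a_acc; a_T; a_C] -> s' a =1 s a.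
    rewrite !inE !negb_or => /and4P[ao ax ay /and4P[az aacc aT aC]] i.
    have h1 : a \notin [:: a_out] by rewrite inE.
    rewrite fr ?fr1 //= !inE !negb_or.
    by rewrite ao ax ay az aacc aT aC.
  apply: (@hoare_then _ _ _ _ _ (fun s2 => written (k * d + d)%N s2)).
    apply: (hoare_loop (n := d) (I := fun z s' => written (k * d + z)%N s')) => //=.
    - by rewrite s's // sd.
    - lia.
    - move=> z s2 s3 h [h1 h2]; split=> [|i j ij]; rewrite ?h //; exact: h2.
    - by rewrite addn0.
    move=> z s2 zd zz fr2 s2W.
    have term l : `|pattern_mx P (N1 + k) (Ordinal zd) l * v l| <= b%:Z.
      rewrite normrM -[leRHS]mul1r ler_pM //.
      by have := pattern_mx01 P (N1 + k) (Ordinal zd) l; rewrite ler_norml; lia.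
    apply: (@hoare_then _ _ _ _ _ (fun s3 => s3 a_acc 0 =
        \sum_l pattern_mx P (N1 + k) (Ordinal zd) l * v l)).
      apply: (hoare_sum (b := b)) => //=.
      + by rewrite fr2 // s's.
      + lia.
      + move=> l s3 xl fr3; rewrite xl !fr3 // (fr2 a_in) // (fr2 a_C) //.
        rewrite (fr2 a_X) // (s's a_in) // (s's a_X) // sd zz.
        by rewrite -!PoszM -!PoszD sX -s'C.
    move=> s3 fr3 s3acc.
    have s3s a : a \notin [:: a_out; a_x; a_y; a_z; a_acc; a_T; a_C] -> s3 a =1 s a.
      move=> ha i; rewrite -s's //; move: ha.
      rewrite !inE !negb_or => /and4P[ao ax ay /and4P[az aacc aT aC]].
      by rewrite fr3 ?fr2 //= !inE !negb_or ?ao ?ax ?ay ?az ?aacc ?aT ?aC.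
    have s3y : s3 a_y 0 = k%:Z by rewrite fr3 // fr2.
    have s3z : s3 a_z 0 = z%:Z by rewrite fr3.
    have cell s4 (c : nat) : s4 a_in =1 s3 a_in -> s4 a_y =1 s3 a_y -> s4 a_z =1 s3 a_z ->
        eval s4 (output_cell c%:Z) = (2 * (k * d + z) + c)%N%:Z.
      by move=> e0 ey ez; rewrite /= e0 ey ez (s3s a_in) // sd s3y s3z -!PoszM -!PoszD.
    have val : eval s3 (Times (Times (var a_L) (Get a_N (Times (var a_z) dim))) (var a_acc))
        = on k (Ordinal zd).
      rewrite /= s3acc /on s3z !s3s // sL sd; congr (_ * _ * _).
      by rewrite -sN /= i00 addn0 PoszM.
    have on_small : small V (on k (Ordinal zd)).
      rewrite smallE; apply: (@le_lt_trans _ _ (d * m * (d * b))%N%:Z).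
        2: by rewrite ltz_nat.
      rewrite /on !normrM !PoszM ler_pM ?mulr_ge0 //.
        by rewrite ler_pM // ger0_norm // lez_nat.
      apply: le_trans (ler_norm_sum _ _ _) _.
      have -> : d%:Z * b%:Z = \sum_(l < d) b%:Z.
        by rewrite sumr_const card_ord -mulr_natl natz.
      by apply: ler_sum => l _; exact: term.
    apply: (@hoare_then _ _ _ _ _ (fun s4 => s4 a_out =1
        update s3 a_out (2 * (k * d + z)).+1%:Z (on k (Ordinal zd)) a_out)).
      by apply: hoare_asg; rewrite val // (cell _ 1%N) // addn1.
    move=> s4 fr4 s4out; apply: hoare_asg.
      by rewrite /= !fr4 // !s3s // sS sD.
    rewrite (cell _ 2%N) ?fr4 //; try by move=> ?; rewrite fr4.
    have -> : eval s4 (Times (var a_S) (var a_D)) = S * D.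
      by rewrite /= !fr4 // !s3s // sS sD.
    have [s2o s2w] := s2W.
    rewrite addn2; split.
      by rewrite update_ne ?s4out ?update_ne ?fr3.
    move=> i j; rewrite addnS ltnS leq_eqVlt => /orP[/eqP q_eq|ij].
      have d0 : (0 < d)%N := leq_ltn_trans (leq0n _) zd.
      have ik : i = k.
        by have := congr1 (divn^~ d) q_eq; rewrite !divnMDl // !divn_small // !addn0.
      have jz : j = Ordinal zd by apply: val_inj; move: q_eq; rewrite ik => /addnI.
      rewrite q_eq ik jz; split; last by rewrite /update !eqxx.
      rewrite update_ne ?s4out; last by apply/eqP; lia.
      by rewrite /update !eqxx.
    have [h1 h2] := s2w i j ij.
    rewrite !update_ne ?s4out ?update_ne ?fr3 ?h1 ?h2 //; apply/eqP; lia.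
  move=> s2 fr2 s2W.
  have s2C : holds_mx s2 a_C (pattern_mx P (N1 + k)) by move=> i j; rewrite fr2 // s'C.
  have s2B : holds_mx s2 a_B (pattern_mx P 1) by move=> i j; rewrite fr2 // s's // sB.
  apply: hoare_weaken.
    apply: (hoare_bool_step stochP dM dV V0
      (p := 1) (q := N1 + k) (a := a_B) (b := a_C)) => //.
    by rewrite fr2 // s's.
  move=> s3 fr3; rewrite add1n -addnS => s3C; split=> //; have [h1 h2] := s2W.
  rewrite mulSn addnC; split=> [|i j ij]; first by rewrite fr3.
  by rewrite !fr3 //; exact: h2.
move=> s5 fr5 [[s5o s5w] _]; split=> // i j; apply: s5w.
rewrite -addnS; apply: leq_trans (leq_mul (ltn_ord i) (leqnn d)).
by rewrite mulSn addnC leq_add2r.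
Qed.

(** * Passage from rational to real matrices *)

Section RealExtension.
Variables (R : realType) (d : nat) (P : 'M[rat]_d).
Let PR := map_mx (ratr : rat -> R) P.

Lemma map_ratr_exp (m : nat) : PR ^+ m = map_mx ratr (P ^+ m).
Proof.
elim: m => [|m IH]; first by rewrite !expr0 map_mx1.
by rewrite !exprS -!mulmxE map_mxM IH.
Qed.

Lemma walk_ratr (m : nat) : walk PR m =2 walk P m.
Proof. by move=> i j; rewrite /walk map_ratr_exp mxE ltr0q. Qed.

Lemma pattern_ratr (m : nat) : pattern PR m = pattern P m.
Proof. by apply/matrixP => i j; rewrite !mxE walk_ratr. Qed.

Lemma stochastic_ratr : stochastic P -> stochastic PR.
Proof.
move=> [P0 P1]; split=> [i j|j]; first by rewrite mxE ler0q.
by under eq_bigr do rewrite mxE; rewrite -rmorph_sum P1 rmorph1.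
Qed.

Lemma irreducible_ratr : irreducible_chain P -> irreducible_chain PR.
Proof.
move=> irrP j i; rewrite (@eq_connect _ _ (transition P)) // => a b.
by rewrite /transition mxE ltr0q.
Qed.

Lemma cyclic_limit_ratr (L m : nat) (alpha : 'I_d -> rat) :
  cyclic_limit PR L (fun i => ratr (alpha i)) m = map_mx ratr (cyclic_limit P L alpha m).
Proof.
apply/matrixP => i j; rewrite !mxE walk_ratr; case: ifP; rewrite ?rmorph0 //.
by rewrite rmorphM rmorph_nat.
Qed.

End RealExtension.

Lemma scale_numq (x : rat) (D : int) : (denq x %| D)%Z ->
  (numq x * (D %/ denq x)%Z)%:~R = D%:~R * x :> rat.
Proof.
move=> /dvdzP[q ->]; rewrite mulzK ?denq_neq0 //.
rewrite -[X in _ = _ * X](divq_num_den x) !rmorphM /=.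
have : (denq x)%:~R != 0 :> rat by rewrite intr_eq0 denq_neq0.
by move: (numq x)%:~R (denq x)%:~R q%:~R => a b c b0; field.
Qed.

Definition prog : code := Then load (Then powers (Then period (Then kernel output))).

Theorem theorem19 (R : realType) :
  exists (prog : command) (T : {poly nat}),
  forall (d : nat) (P : 'M[rat]_d) (iota : 'cV[rat]_d),
  stochastic P -> irreducible_chain P -> distribution_vector iota ->
  exists (s : memory) (t L : nat) (p : 'I_L -> 'cV[rat]_d),
  [/\ exec prog (initial_memory (encode_input P iota)) s t,
      (t <= T.[input_bits P iota])%N,
      encodes_output s p,
      (0 < L <= d)%N
    & forall w : 'cV[R]_d -> R, continuous w ->
        cvgn (average_payoff w (map_mx ratr P) (map_mx ratr iota)) /\
        mean_payoff w (map_mx ratr P) (map_mx ratr iota) =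
          L%:R^-1 * \sum_(i < L) w (map_mx ratr (p i)) ].
Proof.
(* [4 * n ^ 2] bounds the exponent of 2 for the entries of the adjugate; [4 * n] leaves room for the
   further factors [d], [d] and [D], each at most [2 ^ n]. *)
have polyV : polybounded (fun n => 4 * n ^ 2 + 4 * n)%N.
  apply: polyboundedD; apply: polyboundedM; try exact: polybounded_cst.
    by apply: polyboundedM; exact: polybounded_id.
  exact: polybounded_id.
have [T Tcost] := polybounded_code_cost prog polyV polybounded_id.
exists (compile prog), T => d P iota stochP irrP iotaP.
(* In dimension 0 the entries of [iota] would have the empty sum 0 instead of 1. *)
have d0 : (0 < d)%N.
  case: d P iota iotaP stochP irrP => [|//] P iota [_].
  by rewrite big_ord0 => /eqP; rewrite eq_sym oner_eq0.
have := small_initial_memory P iota; have := partial_den_bound P iota.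
have := input_bits_dim P iota; move: (input_bits P iota) => n dn den_le s0n.
pose V := (4 * n ^ 2 + 4 * n)%N.
have n0 : (0 < n)%N by lia.
have nV : (n < V)%N by rewrite /V; nia.
have V0 : (0 < V)%N by lia.
have n2 : (n < 2 ^ n)%N by rewrite ltn_expl.
have nV2 : (2 ^ n < 2 ^ V)%N by rewrite ltn_exp2l.
have dM : (d * d + d <= n)%N by lia.
have ddV : (d * d < 2 ^ V)%N by lia.
have dV : (d < 2 ^ V)%N by lia.
pose r q := nth 0 (entries P iota) q.
pose s0 := initial_memory (encode_input P iota).
pose N := (2 ^ (d * d))%N.
have exL : exists L, (0 < L)%N && (pattern P (N + L) == pattern P N).
  by have [L L0 /eqP PL] := pattern_recurrent stochP; exists L; rewrite L0.
have [L /andP[L0 /eqP PL] Lmin'] := ex_minnP exL.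
have Lmin k : (0 < k < L)%N -> pattern P (N + k) <> pattern P N.
  by move=> /andP[k0 kL] /eqP pk; have := Lmin' k; rewrite k0 pk => /(_ isT); lia.
have Ld : (L <= d)%N := period_le_dim stochP irrP L0 PL Lmin d0.
have [D DE] : exists D : nat, \prod_(q < d * d + d) denq (r q) = D%:Z.
  by exists (absz (\prod_(q < d * d + d) denq (r q))); rewrite gez0_abs // prodr_ge0.
have /andP[Dpos Dle] : 0 < D%:Z <= (2 ^ n)%N%:Z.
  rewrite -DE (_ : \prod_(q < d * d + d) denq (r q) =
    \prod_(q < d * d + d | (q < d * d + d)%N) denq (r q)); first exact: den_le.
  by apply: eq_bigl => q; rewrite ltn_ord.
have D0 : (0 < D)%N by [].
have Dn : (D <= 2 ^ n)%N by [].
pose X q := numq (r q) * (D%:Z %/ denq (r q))%Z.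
have XE q : (q < d * d + d)%N -> (X q)%:~R = D%:R * r q :> rat.
  move=> qn; rewrite scale_numq //; apply/dvdzP.
  by rewrite -DE (bigD1 (Ordinal qn)) //= mulrC; eexists.
have P01 i j : 0 <= P i j <= 1.
  by have := stochastic_exp_le1 stochP 1 i j; rewrite expr1 stochP.1.
have iota01 j : 0 <= iota j 0 <= 1.
  case: iotaP => i0 i1; rewrite i0 /= -i1 (bigD1 j) //= lerDl sumr_ge0 //.
have r01 q : (q < d * d + d)%N -> 0 <= r q <= 1.
  move=> qn; have [/flat_surj[i [j ->]]|ddq] := ltnP q (d * d).
    by rewrite /r nth_entries_mx.
  have qd : (q - d * d < d)%N by lia.
  have := nth_entries_vec P iota (Ordinal qd); rewrite /= subnKC // -/(r q) => ->.
  exact: iota01.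
have X0D q : (q < d * d + d)%N -> 0 <= X q <= D%:Z.
  move=> qn; have /andP[h0 h1] := r01 q qn.
  rewrite -(ler_int rat) -(ler_int rat 0) XE // mulr_ge0 //=.
  by rewrite -[leRHS]mulr1 ler_wpM2l.
pose XP : 'M[int]_d := \matrix_(i, j) X (i * d + j)%N.
pose v (j : 'I_d) := X (d * d + j)%N.
have flat_lt (i j : 'I_d) : (i * d + j < d * d + d)%N by have := flat_ltn i j; lia.
have vec_lt (j : 'I_d) : (d * d + j < d * d + d)%N by rewrite ltn_add2l.
have XPE i j : (XP i j)%:~R = D%:R * P i j :> rat.
  by rewrite mxE XE // /r nth_entries_mx.
have vE j : (v j)%:~R = D%:R * iota j 0 :> rat.
  by rewrite XE // /r nth_entries_vec.
have XPpos i j : (0 < XP i j) = walk P 1 i j.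
  by rewrite -(ltr_int rat) XPE pmulr_rgt0 ?ltr0n // /walk expr1.
pose i0 : 'I_d := Ordinal d0.
pose A := \adj (D%:Z%:M - XP).
pose S := \sum_i A i i0.
(* The program computes over the integers; the adjugate commutes with the embedding into [rat],
   where the results on stationary vectors apply. *)
have AE : map_mx intr A = \adj (D%:R *: (1%:M - P)).
  rewrite map_mx_adj; congr (\adj _); apply/matrixP => i j.
  by rewrite !mxE rmorphB /= rmorphMn /= XE // /r nth_entries_mx mulrBr mulr_natr.
have c0 : D%:R != 0 :> rat by rewrite pnatr_eq0 -lt0n.
have AiE i : \adj (D%:R *: (1%:M - P)) i i0 = (A i i0)%:~R by rewrite -AE [LHS]mxE.
have statA i : \sum_j P i j * (A j i0)%:~R = (A i i0)%:~R.
  rewrite -AiE -(adjugate_stationary stochP) //.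
  by apply: eq_bigr => j _; rewrite -AiE.
have A0 : (A i0 i0)%:~R != 0 :> rat by rewrite -AiE adjugate_diag_neq0.
have [S0 alpha0] := stationary_normalized_gt0 (v := fun i => (A i i0)%:~R)
  stochP irrP statA A0.
have SE : S%:~R = \sum_i (A i i0)%:~R :> rat by rewrite rmorph_sum.
rewrite -SE in S0 alpha0.
pose alpha i : rat := (A i i0)%:~R / S%:~R.
have alpha1 : \sum_i alpha i = 1 by rewrite -mulr_suml -SE divff.
have alpha_stat i : \sum_j P i j * alpha j = alpha i.
  by under eq_bigr do rewrite mulrA; rewrite -mulr_suml statA.
have d_le : (d <= 2 ^ n)%N by lia.
pose m := ((2 * d ^ 2 * D) ^ d)%N.
have m_le : (m <= 2 ^ (4 * n ^ 2))%N.
  (* One [n] for the factor 2, two for [d ^ 2], one for [D]; the last factor [n] bounds the exponent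
     [d]. *)
  have -> : (4 * n ^ 2 = (n + (n + n) + n) * n)%N by lia.
  rewrite expnM /m; apply: (@leq_trans ((2 ^ (n + (n + n) + n)) ^ d)).
    rewrite leq_exp2r // !expnD -mulnn !leq_mul //.
    by rewrite -{1}(expn1 2) leq_pexp2l.
  by rewrite leq_pexp2l ?expn_gt0 //; nia.
have dm_le : (d * (d * (D * m)) < 2 ^ V)%N.
  have h e : (m <= 2 ^ e)%N -> (d * (d * (D * m)) <= 2 ^ (n + (n + (n + e))))%N.
    by move=> me; rewrite !expnD; do 3! [apply: leq_mul => //].
  by apply: leq_ltn_trans (h _ m_le) _; rewrite ltn_exp2l // /V; lia.
have m0 : (0 < m)%N by rewrite /m expn_gt0 !muln_gt0 d0 D0.
have dDV : (d * D < 2 ^ V)%N.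
  apply: leq_ltn_trans dm_le; rewrite leq_mul2l (leq_trans (leq_pmulr D m0)) ?orbT //.
  by rewrite leq_pmull.
have XPD i j : `|(XP - D%:Z%:M) i j| <= D%:Z.
  have /andP[h0 h1] := X0D _ (flat_lt i j).
  by rewrite !mxE ler_norml; case: eqP => _; rewrite ?mulr1n ?mulr0n; lia.
(* The points start at the exponent [N + d], where the period search leaves the pattern. *)
pose num (i : nat) (j : 'I_d) :=
  L%:Z * A j i0 * (\sum_l pattern_mx P (N + d + i) j l * v l).
have correct : hoare V n prog s0 (fun s => s a_out 0 = L%:Z /\
    forall (i : 'I_L) (j : 'I_d), s a_out (2 * (i * d + j)).+1%:Z = num i j /\
      s a_out (2 * (i * d + j)).+2%:Z = S * D%:Z).
  apply: hoare_then.
    apply: (hoare_load (d := d) (num := fun q => numq (r q))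
      (den := fun q => denq (r q))) => //.
    - by move=> q qn; exact: input_num.
    - by move=> q qn; exact: input_den.
    - move=> k kn; have /andP[h0 h1] := den_le k kn.
      by rewrite smallE gtr0_norm // (le_lt_trans h1) // ltz_nat.
    - move=> q qn; have /andP[h0 h1] := X0D q qn; rewrite DE.
      by rewrite smallE ger0_norm // (le_lt_trans h1) // ltz_nat (leq_ltn_trans Dn).
  rewrite DE => s1 fr1 [s1D s1X].
  have s1d : s1 a_in 0 = d%:Z by rewrite fr1.
  have s1XP : holds_mx s1 a_X XP by move=> i j; rewrite s1X // mxE.
  apply: hoare_then.
    apply: (hoare_powers stochP dM dV V0 s1d s1XP _ XPpos) => i j.
    by rewrite mxE; case/andP: (X0D _ (flat_lt i j)).
  move=> s2 fr2 [s2B s2C]; apply: hoare_then.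
    apply: (hoare_period stochP dM ddV dV V0 _ PL Lmin) s2B s2C.
      by rewrite L0.
    by rewrite fr2.
  move=> s3 fr3 [s3C s3L]; apply: hoare_then.
    apply: (hoare_kernel (D := D) (i0 := i0) (X := XP)) => //.
    - by rewrite fr3 // fr2.
    - by rewrite fr3 // fr2.
    - by move=> i j; rewrite fr3 // fr2.
  move=> s4 fr4 [s4N s4S s4m].
  apply: (hoare_output (i0 := i0) (m := m) (b := D) (N := A)) => //.
  - by rewrite (_ : (d * m * (d * D) = d * (d * (D * m)))%N) //; lia.
  - by move=> j; have /andP[h0 h1] := X0D _ (vec_lt j); rewrite ger0_norm.
  - rewrite smallE; apply: (@le_lt_trans _ _ (d * (D * m))%N%:Z); last first.
      by rewrite ltz_nat; apply: leq_ltn_trans dm_le; rewrite leq_pmull.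
    rewrite normrM !PoszM [D%:Z * _]mulrC mulrA ler_wpM2r //.
    apply: le_trans (ler_norm_sum _ _ _) _.
    have -> : d%:Z * m%:Z = \sum_(i < d) m%:Z.
      by rewrite sumr_const card_ord -mulr_natl natz.
    by apply: ler_sum => i _; exact: s4m.
  - by rewrite fr4 // fr3 // fr2.
  - by move=> i j; rewrite fr4 // fr3 // s2B.
  - by move=> i j; rewrite fr4 // s3C.
  - by rewrite fr4 // s3L.
  - by rewrite fr4 // fr3 // fr2.
  - by move=> j; rewrite fr4 // fr3 // fr2 // s1X.
have s0V : small_memory V s0.
  by move=> a i; apply: smallW (ltnW nV) (s0n a i).
have [safe_prog [sout soutE]] := correct.
have nV' : (n < 2 ^ V)%N by lia.
have wf : well_formed prog by [].
have [_ [t exec_t t_le]] := exec_run nV' wf safe_prog s0V.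
pose p (i : 'I_L) : 'cV[rat]_d := cyclic_limit P L alpha (N + d + i)%N *m iota.
exists (run prog s0), t, L, p; split=> //.
- exact: leq_trans t_le (Tcost n).
- split=> // i j k; have [h1 h2] := soutE i j.
  have SD0 : (S * D%:Z)%:~R != 0 :> rat by rewrite rmorphM mulf_neq0.
  split; first by rewrite h2; apply: contraNneq SD0 => ->.
  rewrite h1 h2.
  pose q := \sum_l (pattern_mx P (N + d + i) j l)%:~R * iota l 0.
  have -> : p i j 0 = L%:R * alpha j * q.
    rewrite mxE /q mulr_sumr; apply: eq_bigr => l _; rewrite !mxE.
    by case: walk; rewrite ?mul1r // !mul0r mulr0.
  have -> : (num i j)%:~R = L%:R * (A j i0)%:~R * (D%:R * q) :> rat.
    rewrite /num !intrM rmorph_sum /= /q [D%:R * _]mulr_sumr; congr (_ * _).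
    by apply: eq_bigr => l _; rewrite intrM vE mulrCA.
  rewrite intrM /alpha; move: S0 c0; rewrite -[D%:Z%:~R]/(D%:R).
  by move: (S%:~R) (D%:R : rat) => a b a0 b0; field; rewrite a0 b0.
- by rewrite L0.
- move=> w wc; pose PR := map_mx (ratr : rat -> R) P.
  pose iotaR := map_mx (ratr : rat -> R) iota.
  have lim : (average_payoff w PR iotaR @ \oo -->
      (L%:R^-1 * \sum_(i < L) w (map_mx ratr (p i)) : R))%classic.
    under eq_bigr => i _.
      rewrite /p map_mxM -cyclic_limit_ratr; over.
    apply: (mean_payoff_cyclic (N := N)) => //.
    + exact: (stochastic_ratr R stochP).
    + exact: (irreducible_ratr R irrP).
    + case: iotaP => h0 h1; split=> [i|]; first by rewrite mxE ler0q.
      by under eq_bigr do rewrite mxE; rewrite -rmorph_sum h1 rmorph1.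
    + by rewrite !pattern_ratr.
    + by move=> k /Lmin; rewrite !pattern_ratr.
    + by move=> i; rewrite ltr0q; exact: alpha0.
    + by have := congr1 (ratr : rat -> R) alpha1; rewrite rmorph_sum rmorph1.
    + move=> i; rewrite -[in RHS]alpha_stat rmorph_sum.
      by apply: eq_bigr => j _; rewrite mxE rmorphM.
    + exact: leq_addr.
  split; first exact: cvgP lim.
  exact: cvg_lim lim.
Qed.
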